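(* Let $G$ be a graph that is both minimally $3$-connected and critically $3$-connected, and let $v_3(G)$ denote the number of vertices of degree three in $G$. Then $v_3(G)\ge \frac{|V(G)|+3}{2}$.
   Context: All graphs are finite and simple. A graph is $3$-connected if it has more than $3$ vertices and no vertex cut of size less than $3$. A graph $G$ is minimally $3$-connected if $G$ is $3$-connected but $G\setminus e$ is not $3$-connected for every edge $e$; it is critically $3$-connected if $G$ is $3$-connected but $G-v$ is not $3$-connected for every vertex $v$. *)

(* Defs.v *)
From mathcomp Require Import all_boot.

Set Implicit Arguments.
Unset Strict Implicit.
Unset Printing Implicit Defensive.

(* A finite simple graph with vertex type [T] is given by a symmetric and     *)
(* irreflexive adjacency relation [e : rel T].                                *)

Definition degree (T : finType) (e : rel T) (x : T) : nat :=
  #|[set y | e x y]|.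

Definition v3 (T : finType) (e : rel T) : nat :=
  #|[set x | degree e x == 3]|.

Definition del_edge (T : finType) (e : rel T) (x y : T) : rel T :=
  [rel u v | e u v && ([set u; v] != [set x; y])].

Definition del_vertices (T : finType) (e : rel T) (S : {set T}) :
    rel {x : T | x \notin S} :=
  [rel u v | e (val u) (val v)].
Arguments del_vertices {T} e S.

Definition del_vertex (T : finType) (e : rel T) (v : T) :
    rel {x : T | x \notin [set v]} :=
  del_vertices e [set v].
Arguments del_vertex {T} e v.

Definition connected (T : finType) (e : rel T) : bool :=
  [forall x, forall y, connect e x y].

(* The graph without vertices counts as connected; this is harmless, since    *)
(* only sets of fewer than three vertices in graphs with more than three      *)
(* vertices are ever tested below.                                            *)
Definition vertex_cut (T : finType) (e : rel T) (S : {set T}) : bool :=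
  ~~ connected (del_vertices e S).

Definition three_connected (T : finType) (e : rel T) : bool :=
  (3 < #|T|) && [forall S : {set T}, (#|S| < 3) ==> ~~ vertex_cut e S].

Definition minimally_three_connected (T : finType) (e : rel T) : bool :=
  three_connected e &&
  [forall x, forall y, e x y ==> ~~ three_connected (del_edge e x y)].

Definition critically_three_connected (T : finType) (e : rel T) : bool :=
  three_connected e && [forall v, ~~ three_connected (del_vertex e v)].

(* Main.v *)
(* Call a vertex high if its degree exceeds three. In a minimally 3-connected
   graph every edge between two high vertices is the only edge joining two sides
   of a cut of at most two vertices; call such an edge separable. By an argument
   of Mader, the separable edges between high vertices form a forest, and so they
   do after adding one vertex of degree three with all its edges. Hence the
   number m of high vertices exceeds the number of separable edges by at least
   the number of high neighbours of any vertex of degree three.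
   Let B count the remaining edge ends at high vertices; in the minimally
   3-connected graph these are the edges between high and cubic vertices, so
   B <= 2 v3 + h, where h counts the hubs: the cubic vertices with three high
   neighbours, which by criticality lie in an essential 3-cut. The forest bound
   settles h = 0, up to one extremal case that a contraction excludes. If h > 0,
   contracting a hub into a suitable neighbour keeps 3-connectedness and the
   separable edges between vertices that stay high, and creates a separable edge across the 3-cut of the hub; by
   induction B >= 2 m + h + 4, and even B >= 2 m + h + 5 if some degree exceeds
   four or the graph is minimally 3-connected. Either way v3 >= m + 3. *)
Require Import Defs.
From mathcomp Require Import all_boot all_order all_algebra.
From mathcomp Require Import zify.

Set Implicit Arguments.
Unset Strict Implicit.
Unset Printing Implicit Defensive.

(** * Graphs on a subset of a fixed type *)

(** The forest bound at a single hub gives B >= 2 m + 6 however many hubs there are, while every hub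
    weakens B <= 2 v3 + h by one. Hubs beyond the second must therefore be paid for one by one, and
    this is the task of the contraction. The obstacle is that minimality need not survive a
    contraction, so the induction is carried out for all 3-connected graphs and ends with the
    constant 4 only. The missing unit comes from [excess]: in the minimal graph the two neighbours
    [p] and [q] of the hub, [p] being the one contracted into, are not adjacent, so [p] gains a
    neighbour and has degree above four afterwards. The delicate case of the induction is that [q]
    has degree four and is adjacent to [p]. Then two edges merge, [q] becomes cubic, its separable
    edges no longer join high vertices, and further hubs next to [q] may be lost; the count balances
    because [q] has only two neighbours besides the hub and [p]. *)

Lemma set2_eq (T : finType) (A : {set T}) x y : #|A| <= 2 -> x \in A ->
  y \in A -> x != y -> A = [set x; y].
Proof.
move=> A2 xA yA xy; apply/eqP; rewrite eq_sym eqEcard subUset !sub1set xA yA /=.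
by rewrite cards2 xy.
Qed.

Lemma sum_eq1 (T : finType) (A : {set T}) x : x \in A ->
  \sum_(y in A) (y == x : nat) = 1.
Proof.
move=> xA; rewrite (big_setD1 x) //= eqxx big1 // => y; rewrite !inE.
by case/andP=> /negbTE->.
Qed.

(** The vertices form a subset of a fixed type, so contracting an edge gives a graph over the same
    type and the induction of [hub_bound] stays inside [sgraph T]. *)
Record sgraph (T : finType) := SGraph {
  vset : {set T};
  adj : rel T;
  adjC : symmetric adj;
  adj_irr : irreflexive adj;
  adj_vset : forall x y, adj x y -> x \in vset
}.

Section Graphs.
Context {T : finType}.
Implicit Types (G : sgraph T) (X Y Z K S P Q R D : {set T}).

Definition nbr G x := [set y | adj G x y].
Definition deg G x := #|nbr G x|.

Definition closed_off G X K :=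
  forall x y, x \in X -> adj G x y -> y \notin X -> y \in K.

(** A cut [K] is presented by one side [X], which may overlap [K]; only the witnesses [x] and [y]
    must avoid it. *)
Definition conn3 G :=
  3 < #|vset G| /\
  forall X K x y, X \subset vset G -> closed_off G X K ->
    x \in X -> x \notin K -> y \in vset G -> y \notin X -> y \notin K ->
    2 < #|K|.

Lemma nbrE G x y : (y \in nbr G x) = adj G x y.
Proof. by rewrite inE. Qed.

Lemma adj_vsetr G x y : adj G x y -> y \in vset G.
Proof. by rewrite adjC; apply: adj_vset. Qed.

Lemma adj_neq G x y : adj G x y -> x != y.
Proof. by apply: contraTneq => ->; rewrite adj_irr. Qed.

Lemma conn3_use G X K x y : conn3 G -> X \subset vset G -> closed_off G X K ->
  x \in X -> y \in vset G -> y \notin X -> y \notin K -> #|K| <= 2 -> False.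
Proof.
move=> [_ c3G] XV clX xX yV yX yK K2.
have : 2 < #|K :\: X|.
  apply: (c3G X _ x y) => //; last 2 first.
  - by rewrite inE xX.
  - by rewrite inE (negbTE yK) andbF.
  by move=> u w uX uw wX; rewrite inE wX (clX u w).
by have := subset_leq_card (subsetDl K X); lia.
Qed.

Lemma deg_le G x K : nbr G x \subset K -> deg G x <= #|K|.
Proof. exact: subset_leq_card. Qed.

Lemma conn3_deg G x : conn3 G -> x \in vset G -> 2 < deg G x.
Proof.
move=> c3G xV; rewrite ltnNge; apply/negP => d2.
have [y yV] : exists2 y, y \in vset G & y \notin x |: nbr G x.
  apply/subsetPn; apply/negP => /subset_leq_card.
  by case: c3G => /= V4 _; rewrite cardsU1; rewrite /deg in d2; lia.
rewrite !inE negb_or => /andP[yx yN].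
apply: (@conn3_use G [set x] (nbr G x) x y c3G) => //; rewrite ?inE ?sub1set //.
by move=> u w; rewrite !inE => /eqP ->.
Qed.

Definition far G X S := vset G :\: (X :|: S).

(* The edge [ab] is the only edge from [X] to [far G X S]; that [a] and [b] are
   adjacent is not part of the definition. *)
Definition sep G a b X S : bool :=
  [&& a \in X, b \in far G X S, X \subset vset G, [disjoint X & S], #|S| <= 2
    & [forall x in X, forall y in far G X S,
         adj G x y ==> (x == a) && (y == b)]].

Lemma sep_adj G a b X S x y : sep G a b X S -> adj G x y ->
  x \in X -> y \notin X -> y \notin S -> x = a /\ y = b.
Proof.
case/and5P=> _ _ _ _ /andP[_ /forall_inP H] xy xX yX yS.
have yV := adj_vsetr xy.
have /(_ _) := forall_inP (H x xX) y; rewrite !inE negb_or yX yS yV xy /=.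
by move=> /(_ isT)/andP[/eqP-> /eqP->].
Qed.

Lemma sep_intro G a b X S : a \in X -> b \in vset G -> b \notin X ->
  b \notin S -> X \subset vset G -> [disjoint X & S] -> #|S| <= 2 ->
  (forall x y, x \in X -> y \notin X -> y \notin S -> adj G x y ->
     x = a /\ y = b) ->
  sep G a b X S.
Proof.
move=> aX bV bX bS XV dXS S2 H; rewrite /sep aX XV dXS S2 !inE negb_or bX bS bV /=.
apply/forall_inP => x xX; apply/forall_inP => y.
rewrite !inE negb_or => /andP[/andP[yX yS] _]; apply/implyP => xy.
by have [-> ->] := H x y xX yX yS xy; rewrite !eqxx.
Qed.

Lemma sepC G a b X S : sep G a b X S -> sep G b a (far G X S) S.
Proof.
move=> sp; have := sp; case/and5P=> aX bF XV dXS /andP[S2 _].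
have aS : a \notin S by rewrite (disjointFr dXS).
apply: sep_intro => //.
- exact: (subsetP XV).
- by rewrite !inE aX.
- by apply: subsetDl.
- by rewrite disjoints_subset; apply/subsetP => y; rewrite !inE negb_or => /andP[/andP[]].
move=> x y; rewrite !inE !negb_or !negb_and !negbK => /andP[/andP[xX xS] xV] yF yS xy.
have yX : y \in X by move: yF; rewrite (negbTE yS) (adj_vsetr xy) /= orbF orbF.
by rewrite adjC in xy; case: (sep_adj sp xy yX xX xS).
Qed.

Lemma card_split3 Z P R : [disjoint P & R] ->
  #|Z| = #|Z :&: P| + #|Z :&: R| + #|Z :\: (P :|: R)|.
Proof.
move=> dPR; rewrite -(cardsID (P :|: R) Z) setIUr cardsU.
suff -> : (Z :&: P) :&: (Z :&: R) = set0 by rewrite cards0; lia.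
apply/setP => x; rewrite !inE.
by case xP: (x \in P); rewrite ?andbF //= (disjointFr dPR xP) !andbF.
Qed.

End Graphs.

(** * Crossing two separations *)

(** Splits on all memberships in the goal: the boolean bookkeeping for the cells into which two
    separations divide the vertices. *)
Ltac mem_cases :=
  try done;
  match goal with
  | |- context [in_mem ?x ?A] => case: (in_mem x A) => //=; mem_cases
  end.

Section Crossing.
Context {T : finType}.
Variables (G : sgraph T) (a b z : T) (X S P R : {set T}).
Hypotheses (c3G : conn3 G) (deg_a : 3 < deg G a) (adj_az : adj G a z).
Hypotheses (b'z : b != z) (spX : sep G a b X S) (spP : sep G a z P R).

Let Y := far G X S.
Let Q := far G P R.

Let aX : a \in X. Proof. by case/and5P: spX. Qed.
Let aP : a \in P. Proof. by case/and5P: spP. Qed.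
Let XV : X \subset vset G. Proof. by case/and5P: spX. Qed.
Let PV : P \subset vset G. Proof. by case/and5P: spP. Qed.
Let bY : b \in Y. Proof. by case/and5P: spX. Qed.
Let zQ : z \in Q. Proof. by case/and5P: spP. Qed.
Let dXS : [disjoint X & S]. Proof. by case/and5P: spX. Qed.
Let dPR : [disjoint P & R]. Proof. by case/and5P: spP. Qed.
Let S2 : #|S| <= 2. Proof. by case/and5P: spX => _ _ _ _ /andP[]. Qed.
Let R2 : #|R| <= 2. Proof. by case/and5P: spP => _ _ _ _ /andP[]. Qed.

Let XS x : x \in X -> x \in S = false. Proof. exact: disjointFr. Qed.
Let PR x : x \in P -> x \in R = false. Proof. exact: disjointFr. Qed.

Let bN : (b \in vset G) && (b \notin X) && (b \notin S).
Proof. by move: bY; rewrite !inE negb_or; case/andP=> /andP[-> ->] ->. Qed.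
Let zN : (z \in vset G) && (z \notin P) && (z \notin R).
Proof. by move: zQ; rewrite !inE negb_or; case/andP=> /andP[-> ->] ->. Qed.

Let adjX x y : adj G x y -> x \in X ->
  [|| y \in X, y \in S | (x == a) && (y == b)].
Proof.
move=> xy xX; case yX: (y \in X) => //=; case yS: (y \in S) => //=.
by have [-> ->] := sep_adj spX xy xX (negbT yX) (negbT yS); rewrite !eqxx.
Qed.
Let adjP x y : adj G x y -> x \in P ->
  [|| y \in P, y \in R | (x == a) && (y == z)].
Proof.
move=> xy xP; case yP: (y \in P) => //=; case yR: (y \in R) => //=.
by have [-> ->] := sep_adj spP xy xP (negbT yP) (negbT yR); rewrite !eqxx.
Qed.

Let zXS : (z \in X) || (z \in S).
Proof. by have := adjX adj_az aX; rewrite eqxx eq_sym (negbTE b'z) orbF. Qed.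

(* As [K] has at most one element, the corner [X :&: P] is [a] alone, and [a] has no
   neighbours besides [b], [z] and the element of [K]. *)
Lemma corner (K : {set T}) : #|K| <= 1 -> b \notin K ->
  (forall x y, x \in X :&: P -> x != a -> adj G x y -> y \notin X :&: P ->
     y \in K) ->
  (forall y, adj G a y -> y \notin X :&: P -> y != b -> y != z -> y \in K) ->
  False.
Proof.
move=> K1 bK clK Na.
have [XPa|/set0Pn[x]] := eqVneq ((X :&: P) :\ a) set0.
  have : nbr G a \subset b |: (z |: K).
    apply/subsetP => y; rewrite nbrE => ay; rewrite !inE.
    case: eqVneq => //= yb; case: eqVneq => //= yz.
    apply: Na => //; apply/negP => yXP.
    have : y \in (X :&: P) :\ a by move: yXP; rewrite !inE eq_sym (adj_neq ay).
    by rewrite XPa inE.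
  by move/deg_le; rewrite !cardsU1; move: K1 deg_a; clear; lia.
(* Otherwise [a |: K] is a cut of at most two vertices between the rest of the corner and [b]. *)
move=> xXP; apply: (@conn3_use _ G _ (a |: K) x b c3G _ _ xXP).
- by apply/subsetP => y; rewrite !inE => /and3P[_ /(subsetP XV)].
- move=> u y; rewrite !inE => /and3P[ua uX uP] uy.
  case: eqVneq => //= _ yXP; apply: (clK u) => //; rewrite inE ?uX ?uP //.
- by case/andP: bN => /andP[].
- by rewrite !inE; case/andP: bN => /andP[_ /negbTE ->]; rewrite andbF.
- by rewrite !inE negb_or bK andbT; case/andP: bN => /andP[_ bX] _;
     apply: contraNneq bX => ->.
- by rewrite cardsU1; move: K1; clear; lia.
Qed.

(** Uncrossing: the boundaries of the opposite corners [X :&: P] and [Y :&: Q] have together at most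
    [#|S| + #|R| <= 4] vertices. If the second corner is nonempty, its boundary [K1] has at least
    three, which leaves at most one for the corner at [a], against [corner]. *)
Lemma YQ0 y : y \in Y -> y \in Q -> False.
Proof.
rewrite !inE !negb_or => /andP[/andP[yX yS] yV] /andP[/andP[yP yR] _].
pose K1 := ((S :\: (P :|: R)) :|: (S :&: R)) :|: (R :\: (X :|: S)).
pose K0 := ((S :&: P) :|: (S :&: R)) :|: (R :&: X).
have c0 : #|K0| + #|K1| <= 4.
  have sS := card_split3 S dPR; have sR := card_split3 R dXS.
  rewrite /K0 /K1; rewrite !cardsU; rewrite (setIC R S) in sR.
  by move: sS sR S2 R2; clear; lia.
have K13 : 2 < #|K1|.
  rewrite ltnNge; apply/negP => K12.
  apply: (@conn3_use _ G (far G X S :&: far G P R) K1 y a c3G) => //.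
  - by apply/subsetP => x; rewrite !inE => /andP[/andP[_ ->]].
  - move=> x w; rewrite !inE !negb_or => /andP[/andP[/andP[xX xS] xV] /andP[/andP[xP xR] _]] xw.
    have wV := adj_vsetr xw; rewrite wV.
    rewrite adjC in xw; have := adjX xw; have := adjP xw.
    have := @XS w; have := @PR w.
    move: xX xS xP xR; case: (eqVneq w a) => [->|_] /=; last by mem_cases.
    rewrite aX aP; case: (eqVneq x b) => [xb|_] /=; last by mem_cases.
    by case: (eqVneq x z) => [xz|]; [move: b'z; rewrite -xb xz eqxx | mem_cases].
  - by rewrite !inE !negb_or yX yS yV yP yR.
  - exact: (subsetP XV).
  - by rewrite !inE aX.
  - by rewrite !inE (XS aX) (PR aP) aX aP.
apply: (@corner K0) => //; first by move: c0 K13; clear; lia.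
- by rewrite !inE; case/andP: bN => /andP[_ /negbTE-> /negbTE->]; rewrite andbF.
- move=> x w; rewrite !inE => /andP[xX xP] xa xw.
  by have := adjX xw xX; have := adjP xw xP; rewrite (negbTE xa) /=; mem_cases.
- move=> w aw; rewrite !inE => wXP wb wz; move: wXP; have := adjX aw aX; have := adjP aw aP.
  by rewrite (negbTE wb) (negbTE wz) andbF /=; mem_cases.
Qed.

(** As [Y :&: Q] is empty, [#|X| <= #|Q|] would bound [#|X :&: P| + #|X :&: R|] by the part of [S]
    outside [P] and [R]. The neighbours of [a] other than [b] and [z] lie in those two cells or in
    the rest of [S], so [a] would have degree at most three. *)
Lemma small_Q : #|Q| < #|X|.
Proof.
rewrite ltnNge; apply/negP => XQ.
have sX := card_split3 X dPR; have sS := card_split3 S dPR.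
have eX : X :\: (P :|: R) = Q :&: X.
  by apply/setP => x; rewrite !inE; case xX: (x \in X); rewrite ?andbF ?andbT // (subsetP XV) ?andbT.
have sQ : #|Q| <= #|Q :&: X| + #|S :\: (P :|: R)|.
  rewrite -(cardsID X Q) leq_add2l subset_leq_card //; apply/subsetP => y.
  move=> /setDP[yQ yX]; have := @YQ0 y; rewrite yQ; move: yQ.
  by rewrite !inE (negbTE yX) /=; case: (y \in S) => //= [|/andP[_ ->]]; [case/andP=> -> | move/(_ isT isT)].
have : nbr G a \subset b |: (z |: (((X :&: P) :\ a) :|: (X :&: R) :|: ((S :&: P) :|: (S :&: R)))).
  apply/subsetP => y; rewrite nbrE => ay; rewrite !inE.
  case: (eqVneq y b) => //= yb; case: (eqVneq y z) => //= yz.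
  have := adjX ay aX; have := adjP ay aP; rewrite (negbTE yb) (negbTE yz) !andbF !orbF.
  by rewrite eq_sym (adj_neq ay); mem_cases.
have := cardsD1 a (X :&: P); rewrite inE aX aP => cXP.
move/deg_le; rewrite !cardsU1 !cardsU.
move: deg_a sX sS S2 sQ XQ cXP; rewrite eX.
by clear; lia.
Qed.

(** If [S] lies in [Q], the corner at [a] is bounded by [R :&: X], so by [corner] all of [R] lies in
    [X]. Then [Y] lies in [P], and [a] alone separates it from [z]. *)
Lemma not_S_sub_Q : ~ (S \subset Q).
Proof.
move=> /subsetP SQ.
have SPR y : (y \in S) && ((y \in P) || (y \in R)) = false.
  case yS: (y \in S) => //=; move/SQ: yS.
  by rewrite !inE negb_or => /andP[/andP[/negbTE-> /negbTE->]].
have [RX1|RX2] := leqP #|R :&: X| 1.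
  apply: (@corner (R :&: X)) => //.
  - by rewrite inE; case/andP: bN => /andP[_ /negbTE->]; rewrite andbF.
  - move=> x w; rewrite !inE => /andP[xX xP] xa xw.
    have := adjX xw xX; have := adjP xw xP; rewrite (negbTE xa) /= !orbF.
    by have := SPR w; mem_cases.
  - move=> w aw; rewrite !inE => wXP wb wz; move: wXP.
    have := adjX aw aX; have := adjP aw aP.
    rewrite (negbTE wb) (negbTE wz) !andbF !orbF /=.
    by have := SPR w; mem_cases.
have RX : R \subset X.
  suff <- : R :&: X = R by apply: subsetIr.
  by apply/eqP; rewrite eqEcard subsetIl; move: RX2 R2; clear; lia.
apply: (@conn3_use _ G Y [set a] b z c3G) => //.
- exact: subsetDl.
- move=> u y uY uy yY; rewrite inE.
  have uV := adj_vset uy; have yV := adj_vsetr uy.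
  have := @YQ0 u uY; move: uY yY; rewrite !inE !negb_or uV yV.
  move=> /andP[/andP[uX uS] _]; rewrite andbT => yXS uQ.
  have uR : u \notin R by apply: contraNN uX; apply: (subsetP RX).
  have uP : u \in P by apply/negPn/negP => uP; apply: uQ; rewrite uP uR.
  have ua : u != a by apply: contraNneq uX => ->.
  have := adjP uy uP; rewrite (negbTE ua) orbF => yPR.
  have yX : y \in X.
    apply: contraNT yXS => yX; rewrite yX andTb.
    by apply/negP => yS; have := SPR y; rewrite yS yPR.
  by rewrite adjC in uy; have := adjX uy yX; rewrite (negbTE uX) (negbTE uS) => /andP[].
- by case/andP: zN => /andP[].
- by rewrite !inE zXS.
- by rewrite inE; apply: contraTneq adj_az => ->; rewrite adj_irr.
- by rewrite cards1.
Qed.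

(** * A cubic vertex in two crossing separations *)

Section LowVertex.
Variable v : T.
Hypotheses (deg_v : deg G v = 3) (v'X : v \notin X) (vX1 : #|nbr G v :&: X| <= 1).

(** Passes the condition [avoids] from [X] to [Q]. Two neighbours of [v] in [Q] would force [v] into
    both [R] and [S], with its only neighbour in [X] lying in [Q]; the corner at [a] would then be
    bounded by [R :&: X], which misses [v]. *)
Lemma low_far : v \notin Q -> #|nbr G v :&: Q| <= 1.
Proof.
move=> v'Q; rewrite leqNgt; apply/negP => vQ2.
have vV : v \in vset G.
  have /card_gt0P[y] : 0 < deg G v by rewrite deg_v.
  by rewrite nbrE; apply: adj_vset.
have v'P : v \notin P.
  apply/negP => vP; suff NQ0 : nbr G v :&: Q = set0 by rewrite NQ0 cards0 in vQ2.
  apply/setP => y; rewrite !inE; apply/negP => /andP[vy /andP[yPR yV]].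
  have := adjP vy vP; move: yPR; case: (_ \in P) => //=; case: (_ \in R) => //= _.
  by move/andP=> [/eqP va _]; move: v'X; rewrite va aX.
have vR : v \in R by move: v'Q; rewrite !inE vV andbT negbK (negbTE v'P).
have [t]: exists2 t, t \in nbr G v :&: Q & t \notin X.
  apply/subsetPn; apply/negP => NX.
  suff : #|nbr G v :&: Q| <= #|nbr G v :&: X| by move: vX1 vQ2; clear; lia.
  by apply: subset_leq_card; rewrite subsetI subsetIl.
rewrite inE nbrE => /andP[vt tQ] tX.
have tS : t \in S.
  apply/negPn/negP => tS; apply: (@YQ0 t) => //.
  by rewrite !inE negb_or tX tS (adj_vsetr vt).
have [s sS sQ] : exists2 s, s \in S & s \notin Q by apply/subsetPn/negP/not_S_sub_Q.
have st : s != t by apply: contraNneq sQ => ->.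
have S_eq := set2_eq S2 sS tS st.
have [x0] : exists2 x0, x0 \in nbr G v :&: Q & x0 \notin [set t].
  apply/subsetPn; apply/negP => /subset_leq_card; rewrite cards1.
  by move: vQ2; clear; lia.
rewrite !inE => /andP[vx0 x0Q] x0t.
have x0nS : x0 \notin S.
  by rewrite S_eq !inE (negbTE x0t) orbF; apply: contraNneq sQ => <-; rewrite !inE.
have x0X : x0 \in X.
  apply/negPn/negP => x0X; apply: (@YQ0 x0); last by rewrite !inE.
  by rewrite !inE negb_or x0X x0nS; case/andP: x0Q.
have NvX y : adj G v y -> y \in X -> y = x0.
  move=> vy yX; have x0N : x0 \in nbr G v :&: X by rewrite !inE vx0.
  have /card_le1_eqP := vX1; apply => //; by rewrite !inE vy.
have vS : v \in S.
  have x0a : x0 != a by apply: contraTneq x0Q => ->; rewrite aP.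
  by rewrite adjC in vx0; have := adjX vx0 x0X; rewrite (negbTE v'X) (negbTE x0a) orbF.
have sv : s = v.
  move: vS; rewrite S_eq !inE => /orP[/eqP//|/eqP vt'].
  by move: vt; rewrite vt' adj_irr.
have NS x y : adj G x y -> x \in X -> x \in P ->
    (y \in S) && ((y \in P) || (y \in R)) = false.
  move=> xy xX xP; apply/negbTE/negP; rewrite S_eq sv !inE => /andP[/orP[/eqP yv|/eqP ->]].
    rewrite yv adjC in xy; rewrite (NvX x xy xX) in xP.
    by move: x0Q; rewrite xP.
  by move: tQ; rewrite !inE => /andP[/negbTE->].
apply: (@corner (R :&: X)) => //.
- have := cardsD1 v R; rewrite vR => cR; have : #|R :&: X| <= #|R :\ v|.
    apply: subset_leq_card; apply/subsetP => y; rewrite !inE => /andP[-> yX].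
    by rewrite andbT; apply: contraNneq v'X => <-.
  by move: cR R2; clear; lia.
- by rewrite inE; case/andP: bN => /andP[_ /negbTE->]; rewrite andbF.
- move=> x w; rewrite !inE => /andP[xX xP] xa xw; have := NS _ _ xw xX xP.
  by have := adjX xw xX; have := adjP xw xP; rewrite (negbTE xa) /= !orbF; mem_cases.
- move=> w aw wXP wb wz; have := NS _ _ aw aX aP; move: wXP; rewrite !inE.
  have := adjX aw aX; have := adjP aw aP.
  by rewrite (negbTE wb) (negbTE wz) !andbF !orbF /=; mem_cases.
Qed.

(** Here [Q] contains [v] and cannot be the next side. But [S] then consists of [v] and a vertex [t]
    outside [Q], and [R] has one vertex in [X] and one in [Y]. So [X :&: Q] is bounded by two
    vertices and the edge [za], and as a part of [X] it still avoids [v]. *)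
Lemma low_in_far : v \in Q -> exists S', sep G z a (X :&: Q) S'.
Proof.
move=> vQ; have := vQ; rewrite !inE negb_or => /andP[/andP[v'P v'R] vV].
have vS : v \in S.
  by apply/negPn/negP => v'S; apply: (@YQ0 v) => //; rewrite !inE negb_or v'X v'S.
have [t tS tQ] : exists2 t, t \in S & t \notin Q by apply/subsetPn/negP/not_S_sub_Q.
have vt : v != t by apply: contraNneq tQ => <-.
have S_eq := set2_eq S2 vS tS vt.
have tX : t \notin X by apply/negP => /XS; rewrite tS.
have NS y : (y \in S) && ((y \in P) || (y \in R)) ==> (y == t).
  apply/implyP; rewrite S_eq !inE => /andP[/orP[/eqP->|//]].
  by rewrite (negbTE v'P) (negbTE v'R).
have [r] : exists2 r, r \in R & r \in X.
  suff /card_gt0P[r] : 0 < #|R :&: X| by rewrite inE => /andP[]; exists r.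
  rewrite lt0n; apply/negP => /eqP/cards0_eq RX0.
  have RX y : (y \in R) && (y \in X) = false by rewrite -in_setI RX0 inE.
  apply: (@corner [set t]); first by rewrite cards1.
  - by rewrite inE; case/andP: bN => _; apply: contraNneq => ->.
  - move=> x w; rewrite !inE => /andP[xX xP] xa xw w'.
    move: w'; have := RX w; have := NS w; have := adjX xw xX; have := adjP xw xP.
    by rewrite (negbTE xa) /= !orbF; mem_cases.
  - move=> w aw; rewrite !inE => w' wb wz; move: w'.
    have := RX w; have := NS w; have := adjX aw aX; have := adjP aw aP.
    by rewrite (negbTE wb) (negbTE wz) !andbF !orbF /=; mem_cases.
move=> rR rX.
have [r'] : exists2 r', r' \in R & r' \in Y.
  suff /card_gt0P[r'] : 0 < #|R :&: Y| by rewrite inE => /andP[]; exists r'.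
  rewrite lt0n; apply/negP => /eqP/cards0_eq RY0.
  (* If [R] misses [Y], then [Y] lies in [P] and is cut off by [t] and [a]. *)
  apply: (@conn3_use _ G Y [set t; a] b z c3G) => //.
  - exact: subsetDl.
  - move=> u y uY uy yY; have uV := adj_vset uy; have yV := adj_vsetr uy.
    have uR : u \notin R by apply/negP => uR; have := in_set0 u; rewrite -RY0 inE uR uY.
    have uP : u \in P.
      by apply/negPn/negP => uP; apply: (@YQ0 u) => //; rewrite !inE negb_or uP uR.
    have uX : u \notin X by move: uY; rewrite !inE; case: (u \in X).
    have uS : u \notin S by move: uY; rewrite !inE; case: (u \in S); rewrite ?orbT.
    have ua : u != a by apply: contraNneq uX => ->.
    have := adjP uy uP; rewrite (negbTE ua) orbF => yPR; rewrite !inE.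
    have [yX|yX] := boolP (y \in X).
      rewrite adjC in uy; have := adjX uy yX.
      by rewrite (negbTE uX) (negbTE uS) => /andP[-> _]; rewrite orbT.
    move: yY; rewrite !inE yV negb_or yX andbT negbK => yS.
    by have := NS y; rewrite yS yPR /= => ->.
  - by case/andP: zN => /andP[].
  - by rewrite !inE zXS.
  - rewrite !inE negb_or; apply/andP; split; first by apply: contraNneq tQ => <-.
    by apply: contraTneq adj_az => ->; rewrite adj_irr.
  - by rewrite cards2; case: (_ != _).
move=> r'R r'Y.
have r'X : r' \notin X by move: r'Y; rewrite !inE; case: (r' \in X).
have r'S : r' \notin S by move: r'Y; rewrite !inE; case: (r' \in S); rewrite ?orbT.
have rr' : r != r' by apply: contraNneq r'X => <-.
have R_eq := set2_eq R2 rR r'R rr'.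
have tR : t \notin R.
  rewrite R_eq !inE negb_or; apply/andP; split.
    by apply: contraNneq tX => ->.
  by apply: contraNneq r'S => <-.
(* If [z] were [v], its neighbour in [X] would be [a], and outside [X] only [r'] would be left. *)
have zv : z != v.
  apply/negP => /eqP zv; have av : adj G v a by rewrite adjC -zv.
  suff : nbr G v \subset [set a; r'].
    move/deg_le; rewrite deg_v cards2; by case: (_ != _).
  apply/subsetP => y; rewrite nbrE !inE => vy; have yV := adj_vsetr vy.
  have [yX|yX] := boolP (y \in X).
    have /card_le1_eqP H := vX1; rewrite (H y a) ?eqxx // !inE ?vy ?av ?aX //.
  have yP : y \notin P.
    apply/negP => yP; move: yX; rewrite adjC in vy; have := adjP vy yP.
    by rewrite (negbTE v'P) (negbTE v'R) => /andP[/eqP-> _]; rewrite aX.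
  have [yR|yR] := boolP (y \in R).
    move: yR; rewrite R_eq !inE => /orP[/eqP yr|->]; last by rewrite orbT.
    by move: yX; rewrite yr rX.
  case: (@YQ0 y); last by rewrite !inE negb_or yP yR yV.
  rewrite !inE negb_or yX yV andbT /= S_eq !inE negb_or; apply/andP; split.
    by rewrite eq_sym (adj_neq vy).
  by apply: contraNneq tQ => <-; rewrite !inE negb_or yP yR yV.
exists [set r; v]; apply: sep_intro.
- rewrite inE zQ andbT; move: zXS; rewrite S_eq !inE (negbTE zv) orFb.
  by case/orP=> // /eqP zt; move: tQ; rewrite -zt zQ.
- exact: adj_vset adj_az.
- by rewrite !inE aP andbF.
- rewrite !inE negb_or; apply/andP; split.
    by apply: contraTneq rR => <-; rewrite (PR aP).
  by apply: contraNneq v'P => <-.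
- by apply: subset_trans (subsetIl _ _) XV.
- rewrite disjoint_sym disjoints_subset; apply/subsetP => y; rewrite !inE.
  by case/orP=> /eqP->; rewrite ?rR ?orbT ?andbF ?(negbTE v'X).
- by rewrite cards2; case: (_ != _).
move=> x y; rewrite inE => /andP[xX xQ] yXQ; rewrite !inE negb_or => /andP[yr yv] xy.
have yV := adj_vsetr xy.
have xP : x \notin P by move: xQ; rewrite !inE; case: (x \in P).
have xR : x \notin R by move: xQ; rewrite !inE; case: (x \in R); rewrite ?orbT.
have xa : x != a by apply: contraNneq xP => ->.
have yx : adj G y x by rewrite adjC.
have [yP|yP] := boolP (y \in P).
  by have := adjP yx yP; rewrite (negbTE xP) (negbTE xR) => /andP[/eqP-> /eqP->].
have := adjX xy xX; rewrite (negbTE xa) orbF; case/orP=> [yX|yS].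
  have yR : y \in R.
    by move: yXQ; rewrite !inE yX yV (negbTE yP) !andbT /= negbK.
  move: yR; rewrite R_eq !inE (negbTE yr) /= => /eqP yr'.
  by move: r'X; rewrite -yr' yX.
move: yS; rewrite S_eq !inE (negbTE yv) => /eqP yt.
by move: tQ; rewrite !inE negb_or -yt yP yV yt tR.
Qed.

End LowVertex.

End Crossing.

(** * The forest theorem *)

Section Mader.
Context {T : finType}.
Implicit Types (G : sgraph T) (X Y Z K S P Q R D : {set T}) (h : rel T).

(* [D] holds at most one vertex, the exceptional vertex of degree three. *)
Definition avoids G D X := forall v, v \in D -> v \notin X /\ #|nbr G v :&: X| <= 1.

Lemma avoids_sub G D X Y : X \subset Y -> avoids G D Y -> avoids G D X.
Proof.
move=> XY gY v vD; have [vY vY1] := gY v vD; split.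
  by apply: contraNN vY; apply: (subsetP XY).
by apply: leq_trans vY1; apply: subset_leq_card; apply: setIS.
Qed.

Lemma deg_vset G v : 0 < deg G v -> v \in vset G.
Proof. by case/card_gt0P => y; rewrite nbrE; apply: adj_vset. Qed.

(* [h] stands for a cycle, the vertex in [D] being allowed low degree. A separation
   at [h] with [avoids] and the smallest side crosses the one of the next edge, and
   the far side of the latter is smaller. *)
Lemma mader G h D : conn3 G -> #|D| <= 1 -> (forall v, v \in D -> deg G v = 3) ->
  symmetric h -> subrel h (adj G) ->
  (forall a b, h a b -> exists X S, sep G a b X S) ->
  (forall a b, h a b -> a \notin D -> 3 < deg G a /\ exists2 z, h a z & b != z) ->
  forall a b, ~~ h a b.
Proof.
move=> c3G D1 degD hC hG hsep hdeg.
have main n : forall a b X S, #|X| <= n -> h a b -> sep G a b X S -> ~ avoids G D X.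
  elim: n => [|n IH] a b X S Xn hab sp gX; have aX : a \in X by case/and5P: sp.
    by move: Xn; rewrite leqn0 => /eqP/cards0_eq X0; rewrite X0 inE in aX.
  have aD : a \notin D by apply/negP => /gX; rewrite aX; case.
  have [da [z haz bz]] := hdeg _ _ hab aD.
  have [P [R spP]] := hsep _ _ haz; have az := hG _ _ haz.
  have Qn := small_Q c3G da bz sp spP.
  have hza : h z a by rewrite hC.
  (* The next side is [far G P R] if this contains no vertex of [D], and its intersection with [X]
     otherwise; [small_Q] makes both smaller than [X]. *)
  have [vQ|/pred0Pn[v /=/andP[vD vQ]]] := altP (@pred0P _ (predI (mem D) (mem (far G P R)))).
    apply: (IH z a (far G P R) R) => //; first by move: Xn Qn; clear; lia.
      exact: sepC.
    move=> v vD; have v'Q : v \notin far G P R.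
      by apply/negP => vQ'; have /= := vQ v; rewrite vD vQ'.
    split=> //; have [v'X vX1] := gX v vD.
    exact: (low_far c3G da az bz sp spP (degD v vD) v'X vX1).
  have [v'X vX1] := gX v vD.
  have [S' sp'] := low_in_far c3G da az bz sp spP (degD v vD) v'X vX1 vQ.
  apply: (IH z a _ S' _ hza sp').
    by have := subset_leq_card (subsetIr X (far G P R)); move: Xn Qn; clear; lia.
  by apply: avoids_sub gX; apply: subsetIl.
move=> a b; apply/negP => hab; have [X [S sp]] := hsep _ _ hab.
have hba : h b a by rewrite hC.
(* One of the two sides avoids the vertex of [D]. If that vertex lies on a side, the opposite side
   contains at most one of its neighbours, across the edge [ab]; if it lies in [S], its three
   neighbours cannot include two on each side. *)
have [gX|] := boolP [forall v in D, (v \notin X) && (#|nbr G v :&: X| <= 1)].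
  by apply: (main _ a b X S (leqnn _) hab sp) => v /(forall_inP gX)/andP.
case/forall_inPn => v vD; rewrite negb_and negbK -ltnNge => bad.
apply: (main _ b a (far G X S) S (leqnn _) hba (sepC sp)) => v' v'D.
have -> : v' = v by apply/(card_le1_eqP D1).
have dv := degD v vD; have vV : v \in vset G by apply: deg_vset; rewrite dv.
have dXS : [disjoint X & S] by case/and5P: sp.
have [vX|vX] := boolP (v \in X).
  split; first by rewrite !inE vX.
  apply: leq_trans (_ : #|[set b]| <= 1); last by rewrite cards1.
  apply: subset_leq_card; apply/subsetP => y; rewrite !inE negb_or.
  move=> /andP[vy /andP[/andP[yX yS] _]].
  by have [_ ->] := sep_adj sp vy vX yX yS.
move: bad; rewrite (negbTE vX) /= => bad.
have [vS|vS] := boolP (v \in S).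
  split; first by rewrite !inE vS orbT.
  have : #|nbr G v :&: X| + #|nbr G v :&: far G X S| <= deg G v.
    rewrite -cardsUI.
    have -> : nbr G v :&: X :&: (nbr G v :&: far G X S) = set0.
      by apply/setP => y; rewrite !inE; case: (y \in X); rewrite ?andbF.
    by rewrite cards0 addn0 subset_leq_card // -setIUr subsetIl.
  by rewrite dv; move: bad; clear; lia.
exfalso; suff : #|nbr G v :&: X| <= #|[set a]| by rewrite cards1; move: bad; clear; lia.
apply: subset_leq_card; apply/subsetP => y; rewrite !inE adjC => /andP[vy yX].
by have [-> _] := sep_adj sp vy yX vX vS.
Qed.

(** A leaf in every nonempty subset means that [h] is a forest on [Z]. Removing a leaf lowers the
    degree sum by at most two. *)
Lemma forest_count h (Z : {set T}) : symmetric h -> irreflexive h ->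
  (forall Z' : {set T}, Z' \subset Z -> Z' != set0 ->
     exists2 x, x \in Z' & #|[set y in Z' | h x y]| <= 1) ->
  Z != set0 -> \sum_(x in Z) #|[set y in Z | h x y]| + 2 <= 2 * #|Z|.
Proof.
move=> hC hI; move: {2}#|Z| (leqnn #|Z|) => n.
elim: n Z => [|n IH] Z Zn H Z0; first by move: Zn; rewrite leqn0 cards_eq0 (negbTE Z0).
have [x xZ hx] := H Z (subxx _) Z0.
have cZ := cardsD1 x Z; rewrite xZ in cZ.
rewrite (big_setD1 x) //=.
have [Zx0|Zx0] := eqVneq (Z :\ x) set0.
  rewrite Zx0 big_set0 cZ.
  suff -> : [set y in Z | h x y] = set0 by rewrite cards0 Zx0 cards0.
  apply/setP => y; rewrite !inE; apply/negP => /andP[yZ hxy].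
  have : y \in Z :\ x by rewrite !inE yZ andbT; apply: contraTneq hxy => ->; rewrite hI.
  by rewrite Zx0 inE.
have step : \sum_(y in Z :\ x) #|[set w in Z | h y w]| =
   \sum_(y in Z :\ x) #|[set w in Z :\ x | h y w]| + #|[set y in Z | h x y]|.
  have -> : #|[set y in Z | h x y]| = \sum_(y in Z :\ x) (h x y : nat).
    rewrite -sum1dep_card big_mkcondr /= (big_setD1 x) //= hI add0n.
    by apply: eq_bigr => y _; case: (h x y).
  rewrite -big_split /=; apply: eq_bigr => y _.
  rewrite (cardsD1 x) inE xZ hC /= addnC; congr (#|pred_of_set _| + _).
  by apply/setP => w; rewrite !inE andbA.
rewrite step.
have : \sum_(y in Z :\ x) #|[set w in Z :\ x | h y w]| + 2 <= 2 * #|Z :\ x|.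
  apply: IH => //; first by move: cZ Zn; clear; lia.
  by move=> Z' Z'Z; apply: H; apply: subset_trans Z'Z (subsetDl _ _).
by move: cZ hx; clear; lia.
Qed.

End Mader.

(** * Counting separable edges *)

Section Counting.
Context {T : finType}.
Implicit Types (G : sgraph T) (X Y Z K S P Q R D : {set T}) (h : rel T).

Definition high G := [set x | 3 < deg G x].
Definition sepable G a b := [exists X : {set T}, exists S : {set T}, sep G a b X S].
Definition sdeg G x := #|[set y in high G | adj G x y && sepable G x y]|.
(** The edges at [x] that the forest bound does not see. If the graph is 3-connected and all edges
    between high vertices are separable, a high [x] has exactly its cubic neighbours here. *)
Definition weak_nbr G x :=
  [set y | adj G x y && ~~ ((y \in high G) && sepable G x y)].
Definition wdeg G x := #|weak_nbr G x|.

Lemma sepableP G a b : reflect (exists X S, sep G a b X S) (sepable G a b).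
Proof.
apply: (iffP existsP) => [[X /existsP[S sp]]|[X [S sp]]]; first by exists X, S.
by exists X; apply/existsP; exists S.
Qed.

Lemma sepableC G a b : sepable G a b = sepable G b a.
Proof.
by apply/sepableP/sepableP => -[X [S /sepC sp]]; exists (far G X S), S.
Qed.

Lemma deg_split G x : deg G x = sdeg G x + wdeg G x.
Proof.
rewrite /deg -(cardsID [set y in high G | sepable G x y]); congr (_ + _).
  by apply: eq_card => y; rewrite !inE; case: (adj _ _ _); rewrite ?andbF ?andbT.
by apply: eq_card => y; rewrite !inE; case: (adj _ _ _); rewrite ?andbF ?andbT.
Qed.

(** The side is [v] alone, cut off by its other two neighbours. Hence the edges at one cubic vertex
    may join the forest. *)
Lemma sepable_low G v y : deg G v = 3 -> adj G v y -> sepable G v y.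
Proof.
move=> dv vy; apply/sepableP; exists [set v], (nbr G v :\ y).
have vV := adj_vset vy; have yV := adj_vsetr vy.
apply: sep_intro => //.
- by rewrite inE.
- by rewrite inE eq_sym (adj_neq vy).
- by rewrite !inE eqxx.
- by rewrite sub1set.
- by rewrite disjoints_subset sub1set !inE adj_irr andbF.
- by have := cardsD1 y (nbr G v); rewrite -/(deg G v) dv nbrE vy; clear; lia.
move=> u w; rewrite !inE => /eqP-> wv wN vw; split=> //.
by apply/eqP; apply: contraNT wN => ->; rewrite vw.
Qed.

(** A subset without a leaf would give each of its vertices two [h]-neighbours inside it, which
    [mader] excludes. *)
Lemma forest_of_mader G h D Z : conn3 G -> #|D| <= 1 ->
  (forall v, v \in D -> deg G v = 3) -> symmetric h -> subrel h (adj G) ->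
  subrel h (sepable G) -> Z \subset high G :|: D ->
  Z != set0 -> \sum_(x in Z) #|[set y in Z | h x y]| + 2 <= 2 * #|Z|.
Proof.
move=> c3G D1 degD hC hG hsep ZF; apply: forest_count => //.
  by move=> x; apply/negP => /hG; rewrite adj_irr.
move=> Z' Z'Z /set0Pn[x0 x0Z'].
have [/exists_inP[x xZ' hx]|none] := boolP [exists x in Z', #|[set y in Z' | h x y]| <= 1].
  by exists x.
have two x : x \in Z' -> 1 < #|[set y in Z' | h x y]|.
  by move=> xZ'; rewrite ltnNge; apply: contraNN none => hx; apply/exists_inP; exists x.
pose h' := [rel x y | [&& x \in Z', y \in Z' & h x y]].
suff H : forall a b, ~~ h' a b.
  have /card_gt0P[y] : 0 < #|[set y in Z' | h x0 y]| by apply: ltnW (two _ x0Z').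
  by rewrite inE => /andP[yZ' hxy]; have := H x0 y; rewrite /= x0Z' yZ' hxy.
apply: (mader c3G D1 degD).
- by move=> x y; rewrite /= hC andbCA.
- by move=> x y /and3P[_ _ /hG].
- by move=> a b /and3P[_ _ /hsep/sepableP].
move=> a b /and3P[aZ' bZ' hab] aD; split.
  by have := subsetP ZF _ (subsetP Z'Z _ aZ'); rewrite !inE (negbTE aD) orbF.
have [z] : exists2 z, z \in [set y in Z' | h a y] & z \notin [set b].
  apply/subsetPn/negP => /subset_leq_card; rewrite cards1.
  by move: (two a aZ'); clear; lia.
rewrite !inE => /andP[zZ' haz] zb; exists z; last by rewrite eq_sym.
by rewrite /= aZ' zZ'.
Qed.

Lemma count_high G : conn3 G -> high G != set0 ->
  \sum_(x in high G) sdeg G x + 2 <= 2 * #|high G|.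
Proof.
move=> c3G F0; pose h := [rel x y | adj G x y && sepable G x y].
have := @forest_of_mader G h set0 (high G) c3G; apply => //.
- by rewrite cards0.
- by move=> v; rewrite inE.
- by move=> x y; rewrite /= adjC sepableC.
- by move=> x y /andP[].
- by move=> x y /andP[].
- exact: subsetUl.
Qed.

(** In the forest on [v |: high G] each edge at [v] adds two to the degree sum, and the additional
    vertex cancels the [+ 2] of [forest_count]. *)
Lemma count_low G v : conn3 G -> deg G v = 3 ->
  \sum_(x in high G) sdeg G x + 2 * #|nbr G v :&: high G| <= 2 * #|high G|.
Proof.
move=> c3G dv; set F := high G.
have vF : v \notin F by rewrite inE dv.
pose h := [rel x y | [&& adj G x y, sepable G x y, x \in v |: F & y \in v |: F]].
have := @forest_of_mader G h [set v] (v |: F) c3G.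
rewrite cards1 => /(_ isT) H; have {H} : \sum_(x in v |: F) #|[set y in v |: F | h x y]| + 2 <= 2 * #|v |: F|.
  apply: H.
  - by move=> w; rewrite inE => /eqP->.
  - by move=> x y; rewrite /= adjC sepableC; congr [&& _, _ & _]; rewrite andbC.
  - by move=> x y /and4P[].
  - by move=> x y /and4P[].
  - by rewrite setUC.
  - by apply/set0Pn; exists v; rewrite !inE eqxx.
rewrite cardsU1 vF (big_setU1 _ vF) /=.
have -> : #|[set y in v |: F | h v y]| = #|nbr G v :&: F|.
  apply: eq_card => y; rewrite !inE eqxx orTb andTb.
  case vy: (adj G v y); rewrite ?andbF //= (sepable_low dv vy) andTb.
  by rewrite eq_sym (negbTE (adj_neq vy)) /= andbb.
have -> : \sum_(x in F) #|[set y in v |: F | h x y]| =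
    \sum_(x in F) sdeg G x + #|nbr G v :&: F|.
  have -> : #|nbr G v :&: F| = \sum_(x in F) (adj G v x : nat).
    rewrite -sum1_card big_mkcond [RHS]big_mkcond; apply: eq_bigr => x _.
    by rewrite !inE; case: (adj _ _ _); case: (3 < _).
  rewrite -big_split; apply: eq_bigr => x xF /=.
  rewrite (cardsD1 v) addnC; congr (_ + _).
    apply: eq_card => y; rewrite !inE.
    have xF' : 3 < deg G x by move: xF; rewrite inE.
    rewrite xF' orbT /=; case: eqVneq => [->|_] /=; first by rewrite dv.
    by case: (3 < deg G y) => //=; rewrite andbT.
  rewrite !inE eqxx /= andbT adjC.
  have xF' : 3 < deg G x by move: xF; rewrite inE.
  case vx: (adj G v x) => //=; by rewrite sepableC (sepable_low dv vx) xF' orbT.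
by clear; lia.
Qed.

(** The edges at the cubic vertex [v] are separable, so a separable [xy] would close a triangle
    against [mader]. This controls the edges that merge in a contraction. *)
Lemma triangle_low G v x y : conn3 G -> deg G v = 3 -> x \in high G -> y \in high G ->
  adj G v x -> adj G v y -> adj G x y -> sepable G x y = false.
Proof.
move=> c3G dv xF yF vx vy xy; apply/negbTE/negP => sxy.
pose t := [set v; x; y].
pose h := [rel a b | [&& a != b, a \in t & b \in t]].
have good a b : adj G a b && sepable G a b = adj G b a && sepable G b a.
  by rewrite adjC sepableC.
have ht a b : h a b -> adj G a b && sepable G a b.
  have gvx : adj G v x && sepable G v x by rewrite vx sepable_low.
  have gvy : adj G v y && sepable G v y by rewrite vy sepable_low.
  have gxy : adj G x y && sepable G x y by rewrite xy sxy.
  rewrite /= !inE => /and3P[+ ta tb].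
  case/orP: ta => [/orP[]|] /eqP->; case/orP: tb => [/orP[]|] /eqP->;
    rewrite ?eqxx // => _; by rewrite good.
have vx' := adj_neq vx; have vy' := adj_neq vy; have xy' := adj_neq xy.
suff H : forall a b, ~~ h a b.
  by have := H x y; rewrite /= !inE xy' !eqxx ?orbT.
apply: (@mader _ G h [set v] c3G).
- by rewrite cards1.
- by move=> w; rewrite inE => /eqP->.
- by move=> a b /=; rewrite eq_sym; congr (_ && _); rewrite andbC.
- by move=> a b /ht/andP[].
- by move=> a b /ht/andP[_ /sepableP].
move=> a b; rewrite /= !inE => /and3P[ab ta tb] av.
rewrite (negbTE av) /= in ta; split; first by case/orP: ta => /eqP->; move: xF yF; rewrite !inE.
have [bv|bv] := eqVneq b v.
  rewrite bv; case/orP: ta => /eqP->; [exists y | exists x] => //.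
    by rewrite xy' !inE !eqxx !orbT.
  by rewrite eq_sym xy' !inE !eqxx !orbT.
exists v; last by rewrite bv.
by rewrite /= !inE av eqxx; case/orP: ta => ->; rewrite ?orbT.
Qed.

End Counting.

(** * Three-cuts through an edge at a cubic vertex *)

Section Contraction.
Context {T : finType}.
Implicit Types (G : sgraph T) (X Y Z K S P Q R D : {set T}) (h : rel T).

(** The obstruction to contracting [vp]: a cut formed by [v], [p] and a vertex [t], which may
    coincide with one of them. *)
Definition cut_through G v p :=
  [exists t, exists X : {set T}, let K := [set v; p; t] in
   [&& X \subset vset G, [disjoint X & K], X != set0, far G X K != set0
     & [forall x in X, nbr G x \subset X :|: K]]].

Lemma conn3_closed G X K : conn3 G -> X \subset vset G -> closed_off G X K ->
  #|K| <= 2 -> X != set0 -> far G X K != set0 -> False.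
Proof.
move=> c3G XV clX K2 /set0Pn[x xX] /set0Pn[y]; rewrite !inE negb_or.
by move=> /andP[/andP[yX yK] yV]; apply: (conn3_use c3G XV clX xX yV).
Qed.

(** Each side must contain a neighbour of [v], since otherwise [p] and [t] alone would be a cut;
    besides [p], only [w] and [q] are available. *)
Lemma cut_separates G v w p q : conn3 G -> adj G v w -> adj G v q ->
  nbr G v \subset [set w; p; q] -> cut_through G v p ->
  exists t (A : {set T}), [/\ A \subset vset G, [disjoint A & [set v; p; t]],
    closed_off G A [set v; p; t], w \in A & q \in far G A [set v; p; t]].
Proof.
move=> c3G vw vq Nv /existsP[t /existsP[X /and5P[XV dXK X0 Y0 /forall_inP clX]]].
set K := [set v; p; t] in dXK Y0 clX.
have clX' : closed_off G X K.
  move=> x y xX xy yX; have := subsetP (clX x xX) y.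
  by rewrite nbrE xy in_setU (negbTE yX) => /(_ isT).
have K2 : #|[set p; t]| <= 2 by rewrite cards2; case: (_ != _).
have NK y : adj G v y -> y \notin K -> (y == w) || (y == q).
  move=> vy; have := subsetP Nv y; rewrite nbrE vy !inE => /(_ isT).
  by case: (y == p); rewrite ?orbT ?orbF.
have disjF x : x \in X -> x \in K = false by apply: disjointFr.
have [x xX vx] : exists2 x, x \in X & adj G v x.
  have [/exists_inP//|none] := boolP [exists x in X, adj G v x]; exfalso.
  apply: (@conn3_closed _ X [set p; t] c3G XV) => //.
    move=> x y xX xy yX; have := clX' x y xX xy yX; rewrite !inE => /orP[/orP[/eqP yv|->//]|->].
      by case: (negP none); apply/exists_inP; exists x => //; rewrite adjC -yv.
    by rewrite orbT.
  case/set0Pn: Y0 => y; rewrite !inE => /andP[yXK yV]; apply/set0Pn; exists y.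
  by rewrite !inE yV andbT; apply: contra yXK => /or3P[|/eqP->|/eqP->]; rewrite ?eqxx ?orbT // => ->.
have [y yY vy] : exists2 y, y \in far G X K & adj G v y.
  have [/exists_inP//|none] := boolP [exists y in far G X K, adj G v y]; exfalso.
  apply: (@conn3_closed _ (far G X K) [set p; t] c3G) => //; first exact: subsetDl.
    move=> y u yY yu uY; have uV := adj_vsetr yu.
    have yX : y \notin X by move: yY; rewrite !inE; case: (y \in X).
    have yK : y \notin K by move: yY; rewrite inE in_setU; case: (y \in K); rewrite ?orbT.
    have uX : u \notin X.
      apply/negP => uX; rewrite adjC in yu; have := clX' u y uX yu yX.
      by rewrite (negbTE yK).
    move: uY; rewrite !inE (negbTE uX) uV andbT /= negbK.
    case/orP=> [/orP[/eqP uv|->//]|->]; last by rewrite orbT.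
    by case: (negP none); apply/exists_inP; exists y => //; rewrite adjC -uv.
  apply/set0Pn; exists x; rewrite !inE (subsetP XV) // andbT xX andbT.
  have := disjF x xX; rewrite !inE => /negbT; rewrite !negb_or => /andP[/andP[xv xp] xt].
  by rewrite (negbTE xp) (negbTE xt).
have yX : y \notin X by move: yY; rewrite !inE; case: (y \in X).
have yK : y \notin K by move: yY; rewrite inE in_setU; case: (y \in K); rewrite ?orbT.
have xy : x != y by apply: contraNneq yX => <-.
have /orP[/eqP xw|/eqP xq] := NK x vx (negbT (disjF x xX)).
  have /orP[/eqP yw|/eqP yq] := NK y vy yK; first by rewrite xw yw eqxx in xy.
  by exists t, X; rewrite -xw -yq; split.
have /orP[/eqP yw|/eqP yq] := NK y vy yK; last by rewrite xq yq eqxx in xy.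
exists t, (far G X K); rewrite -xq -yw; split => //.
- exact: subsetDl.
- by rewrite disjoints_subset; apply/subsetP => u; rewrite inE in_setU in_setC;
    case: (u \in K); rewrite ?orbT.
- move=> u z uF uz zF; have zV := adj_vsetr uz.
  apply/negPn/negP => zK; have zX : z \in X.
    by apply: contraNT zF => zX; rewrite inE in_setU negb_or zX zK.
  have uX : u \notin X by move: uF; rewrite !inE; case: (u \in X).
  have uK : u \notin K by move: uF; rewrite inE in_setU; case: (u \in K); rewrite ?orbT.
  by rewrite adjC in uz; have := clX' z u zX uz uX; rewrite (negbTE uK).
rewrite inE (subsetP XV) // andbT in_setU negb_or (disjF x xX) andbT.
by rewrite inE in_setU xX.
Qed.

(* Two such cuts cross; counting their four corners isolates [q]. *)
Lemma one_cut_through G v w p q : conn3 G -> adj G v w -> adj G v p -> adj G v q ->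
  nbr G v \subset [set w; p; q] -> w != p -> w != q -> p != q -> 3 < deg G q ->
  cut_through G v p -> cut_through G v q -> False.
Proof.
move=> c3G vw vp vq Nv wp wq pq dq cp cq.
have [t1 [A [AV dA clA wA qB]]] := cut_separates c3G vw vq Nv cp.
have Nv' : nbr G v \subset [set w; q; p] by rewrite setUAC.
have [t2 [P [PV dP clP wP pQ]]] := cut_separates c3G vw vp Nv' cq.
have NvE y : adj G v y -> [|| y == w, y == p | y == q].
  by move=> vy; have := subsetP Nv y; rewrite nbrE vy !inE -orbA => ->.
have disA x : x \in A -> [&& x != v, x != p & x != t1].
  by move/(disjointFr dA); rewrite !inE => /negbT; rewrite !negb_or -andbA.
have disP x : x \in P -> [&& x != v, x != q & x != t2].
  by move/(disjointFr dP); rewrite !inE => /negbT; rewrite !negb_or -andbA.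
have [qA q1] : q \notin A /\ (q != t1).
  by move: qB; rewrite !inE !negb_or => /andP[/and3P[-> /andP[_ _] ->] _].
have [pP p2] : p \notin P /\ (p != t2).
  by move: pQ; rewrite !inE !negb_or => /andP[/and3P[-> /andP[_ _] ->] _].
have qV := adj_vsetr vq; have pV := adj_vsetr vp; have wV := adj_vsetr vw.
have vA : v \notin A by apply/negP => /disA; rewrite eqxx.
have vP : v \notin P by apply/negP => /disP; rewrite eqxx.
have pA : p \notin A by apply/negP => /disA; rewrite eqxx andbF.
have qP : q \notin P by apply/negP => /disP; rewrite eqxx andbF.
have wD := disA w wA; have wD2 := disP w wP.
have outA x y : adj G x y -> x \in A -> [|| y \in A, y == v, y == p | y == t1].
  by move=> xy xA; case yA: (y \in A) => //=; have := clA x y xA xy (negbT yA); rewrite !inE orbA.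
have outP x y : adj G x y -> x \in P -> [|| y \in P, y == v, y == q | y == t2].
  by move=> xy xP; case yP: (y \in P) => //=; have := clP x y xP xy (negbT yP); rewrite !inE orbA.
have vnot x : adj G v x -> x != w -> (x == p) || (x == q) by move/NvE; case: eqP.
(* [L] is the boundary of [A :&: P] apart from [v], whose only neighbour in that corner is [w]. If
   [L] had at most one element, [w |: L] would be a cut, or [w] would have degree below three. *)
pose L := [set t in [set t1; t2] | ((t \in P) || (t == t2)) && ((t \in A) || (t == t1))].
have L2 : 1 < #|L|.
  rewrite ltnNge; apply/negP => L1.
  have stepL x y : adj G x y -> x \in A -> x \in P -> y != v -> y \notin A :&: P -> y \in L.
    move=> xy xA xP yv; have := outA x y xy xA; have := outP x y xy xP.
    rewrite !inE (negbTE yv) /=.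
    have [->|yp] := eqVneq y p; first by rewrite (negbTE pP) (negbTE pq) (negbTE p2).
    have [->|yq] := eqVneq y q; first by rewrite (negbTE qA) (negbTE q1).
    by case: (y \in A); case: (y \in P); case: (y == t1); case: (y == t2).
  have [W0|W0] := eqVneq ((A :&: P) :\ w) set0.
    have : nbr G w \subset v |: L.
      apply/subsetP => y; rewrite nbrE in_setU1 => wy; case: eqVneq => //= yv.
      apply: (stepL w) => //; apply/negP => yAP.
      have : y \in (A :&: P) :\ w by rewrite in_setD1 yAP andbT eq_sym (adj_neq wy).
      by rewrite W0 inE.
    move/deg_le; have := conn3_deg c3G wV; rewrite cardsU1; move: L1; clear; lia.
  apply: (@conn3_closed G ((A :&: P) :\ w) (w |: L) c3G) => //.
  - by apply/subsetP => x; rewrite !inE => /and3P[_ /(subsetP AV)].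
  - move=> x y; rewrite in_setD1 inE => /and3P[xw xA xP] xy.
    rewrite in_setD1 in_setU1; case: eqVneq => //= yw; apply: (stepL x) => //.
    apply: contraTneq xy => ->; rewrite adjC; apply/negP => /vnot/(_ xw).
    by case/orP=> /eqP xe; move: pA qP; rewrite -xe ?xA ?xP.
  - by rewrite cardsU1; move: L1; clear; lia.
  apply/set0Pn; exists q; rewrite !inE (negbTE qA) (negbTE q1) andbF /= qV eq_sym.
  by rewrite (negbTE wq) !andbF.
have LE t : t \in L -> (t = t1 /\ (t \in P \/ t1 = t2)) \/ (t = t2 /\ (t \in A \/ t1 = t2)).
  rewrite !inE => /andP[/orP[]/eqP-> /andP[/orP[h1|/eqP h1] /orP[h2|/eqP h2]]]; intuition congruence.
have t12 : t1 != t2.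
  apply: contraTneq L2 => t12; rewrite -leqNgt; apply: leq_trans (_ : #|[set t1]| <= 1); last by rewrite cards1.
  by apply: subset_leq_card; apply/subsetP => t; rewrite !inE -t12 orbb => /andP[].
have L_eq : L = [set t1; t2].
  by apply/eqP; rewrite eqEcard cards2 t12 L2 andbT; apply/subsetP => t; rewrite !inE => /andP[].
have t1P : t1 \in P.
  by have := set21 t1 t2; rewrite -L_eq => /LE[[_ [//|/eqP]]|[/eqP]]; rewrite (negbTE t12).
have t2A : t2 \in A.
  by have := set22 t1 t2; rewrite -L_eq => /LE[[/eqP]|[_ [//|/eqP]]]; rewrite ?(negbTE t12) // eq_sym (negbTE t12).
have farA x : x \in far G A [set v; p; t1] -> [&& x \notin A, x != v, x != p & x != t1].
  by rewrite !inE !negb_or => /andP[/and3P[-> /andP[-> ->] ->] _].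
have farP x : x \in far G P [set v; q; t2] -> [&& x \notin P, x != v, x != q & x != t2].
  by rewrite !inE !negb_or => /andP[/and3P[-> /andP[-> ->] ->] _].
have wfar Z K : w \notin Z -> w \notin K -> far G Z K != set0.
  by move=> wZ wK; apply/set0Pn; exists w; rewrite !inE negb_or wZ wK.
have notA x y : x \in far G A [set v; p; t1] -> adj G x y -> y \notin A.
  move=> /farA/and4P[xA xv xp xt] xy; apply/negP => yA.
  by rewrite adjC in xy; have := outA y x xy yA; rewrite (negbTE xA) (negbTE xv) (negbTE xp) (negbTE xt).
have notP x y : x \in far G P [set v; q; t2] -> adj G x y -> y \notin P.
  move=> /farP/and4P[xP xv xp xt] xy; apply/negP => yP.
  by rewrite adjC in xy; have := outP y x xy yP; rewrite (negbTE xP) (negbTE xv) (negbTE xp) (negbTE xt).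
have notv x y : x \in far G A [set v; p; t1] -> x != q -> adj G x y -> y != v.
  move=> /farA/and4P[xA _ xp _] xq xy; apply: contraTneq xy => ->; rewrite adjC.
  by apply/negP => /NvE; rewrite (negbTE xp) (negbTE xq) !orbF => /eqP xw; rewrite xw wA in xA.
have w1 : w \notin far G A [set v; p; t1] by rewrite !inE wA.
(* Now [t1] lies in [P] and [t2] in [A], so inside the far side of [A] one cell is bounded by [p]
   and [q], the other by [q] and [t1]. Both are empty, and [q] is left with the neighbours [v], [p]
   and [t1]. *)
have BQ x : x \in far G A [set v; p; t1] -> x \in far G P [set v; q; t2] -> False.
  move=> xB xQ.
  apply: (@conn3_closed G (far G A [set v; p; t1] :&: far G P [set v; q; t2]) [set p; q] c3G).
  - by apply: subset_trans (subsetIl _ _) _; apply: subsetDl.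
  - move=> u y; rewrite inE => /andP[uB uQ] uy yZ; have yV := adj_vsetr uy.
    have uq : u != q by case/and4P: (farP u uQ).
    have yA := notA u y uB uy; have yP := notP u y uQ uy; have yv := notv u y uB uq uy.
    have y1 : y != t1 by apply: contraNneq yP => ->.
    have y2 : y != t2 by apply: contraNneq yA => ->.
    move: yZ; rewrite !inE (negbTE yA) (negbTE yP) (negbTE yv) (negbTE y1) (negbTE y2) yV /=.
    by rewrite !orbF !andbT negb_and !negbK.
  - by rewrite cards2; case: (_ != _).
  - by apply/set0Pn; exists x; rewrite inE xB.
  by apply: wfar; rewrite !inE ?wA // negb_or wp.
have BP x : x \in far G A [set v; p; t1] -> x \in P -> False.
  move=> xB xP.
  apply: (@conn3_closed G (far G A [set v; p; t1] :&: P) [set q; t1] c3G).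
  - by apply: subset_trans (subsetIl _ _) _; apply: subsetDl.
  - move=> u y; rewrite inE => /andP[uB uP] uy yZ; have yV := adj_vsetr uy.
    have uq : u != q by case/and3P: (disP u uP).
    have yA := notA u y uB uy; have yv := notv u y uB uq uy.
    have y2 : y != t2 by apply: contraNneq yA => ->.
    have := outP u y uy uP; move: yZ; rewrite !inE (negbTE yA) (negbTE yv) (negbTE y2) yV /=.
    have [->|yp] := eqVneq y p; first by rewrite (negbTE pP) (negbTE pq).
    by case: (y \in P); case: (y == t1); case: (y == q).
  - by rewrite cards2; case: (_ != _).
  - by apply/set0Pn; exists x; rewrite inE xB.
  by apply: wfar; rewrite !inE ?wA // negb_or wq; case/and3P: wD.
suff : nbr G q \subset [set v; p; t1].
  by move/deg_le; rewrite -!setUA !cardsU1 cards1; move: dq; clear; lia.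
apply/subsetP => y; rewrite nbrE => qy; apply/negPn/negP => yK.
have yA := notA q y qB qy; have yV := adj_vsetr qy.
have yB : y \in far G A [set v; p; t1] by rewrite inE in_setU negb_or yA yK.
apply: (BQ y yB); have yP : y \notin P by apply/negP; apply: BP.
rewrite !inE (negbTE yP) yV !orFb andbT !negb_or (eq_sym y q) (adj_neq qy).
by case/and4P: (farA y yB) => _ -> _ _ /=; apply: contraNneq yA => ->.
Qed.

End Contraction.

(** * Contraction *)

Section Contract.
Context {T : finType}.
Implicit Types (G : sgraph T) (X Y Z K S P Q R D : {set T}) (h : rel T).

Definition contract_rel G v p x y :=
  [&& x \in vset G :\ v, y \in vset G :\ v, x != y &
     [|| adj G x y, (x == p) && adj G v y | (y == p) && adj G v x]].

Lemma contract_relC G v p : symmetric (contract_rel G v p).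
Proof.
by move=> x y; rewrite /contract_rel andbCA (eq_sym x) (adjC G x) [X in _ || X]orbC.
Qed.

Lemma contract_rel_irr G v p : irreflexive (contract_rel G v p).
Proof. by move=> x; rewrite /contract_rel eqxx !andbF. Qed.

Lemma contract_rel_vset G v p x y :
  contract_rel G v p x y -> x \in vset G :\ v.
Proof. by case/and4P. Qed.

(* The edge [vp] is contracted into the vertex [p]. *)
Definition contract G v p : sgraph T :=
  SGraph (contract_relC G v p) (@contract_rel_irr G v p) (@contract_rel_vset G v p).

Lemma adj_contract G v p x y : adj (contract G v p) x y ->
  [/\ x != v, y != v, x != y &
   [\/ adj G x y, x = p /\ adj G v y | y = p /\ adj G v x]].
Proof.
case/and4P; rewrite !inE => /andP[xv _] /andP[yv _] xy.
case/or3P=> [|/andP[/eqP ? ?]|/andP[/eqP ? ?]]; split=> //.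
- by constructor 1.
- by constructor 2.
by constructor 3.
Qed.

Lemma adj_contract_old G v p x y : adj G x y -> x != v -> y != v ->
  adj (contract G v p) x y.
Proof.
move=> xy xv yv; rewrite /= /contract_rel !inE xv yv (adj_vset xy) (adj_vsetr xy).
by rewrite (adj_neq xy) xy.
Qed.

Lemma adj_contract_new G v p x : adj G v p -> adj G v x -> x != p ->
  adj (contract G v p) p x.
Proof.
move=> vp vx xp; rewrite /= /contract_rel !inE !(eq_sym _ v) (adj_neq vp) (adj_neq vx).
by rewrite (adj_vsetr vp) (adj_vsetr vx) (eq_sym p) xp eqxx vx orbT.
Qed.

Lemma nbr_contract G v p x : adj G v p -> x != v -> x != p ->
  nbr (contract G v p) x = if adj G v x then p |: (nbr G x :\ v) else nbr G x.
Proof.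
move=> vp xv xp; apply/setP => y; rewrite nbrE; apply/idP/idP.
  case/adj_contract => _ yv xy [xy'|[xe]|[-> vx]]; last by rewrite vx !inE eqxx.
    by case: ifP => _; rewrite !inE xy' ?yv ?orbT.
  by rewrite xe eqxx in xp.
case: ifP => vx; rewrite !inE.
  case/orP=> [/eqP->|/andP[yv xy]]; last exact: adj_contract_old.
  by rewrite adjC; apply: adj_contract_new.
move=> xy; apply: adj_contract_old => //.
by apply: contraFneq vx => <-; rewrite adjC.
Qed.

Lemma nbr_contract_p G v p : adj G v p ->
  nbr (contract G v p) p = (nbr G p :\ v) :|: (nbr G v :\ p).
Proof.
move=> vp; apply/setP => y; rewrite nbrE !inE; apply/idP/idP.
  case/adj_contract => _ yv py [->|[_ ->]|[yp _]]; first by rewrite yv.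
    by rewrite (eq_sym y p) py orbT.
  by rewrite yp eqxx in py.
case/orP=> [/andP[yv py]|/andP[yp vy]]; last exact: adj_contract_new.
by apply: adj_contract_old => //; rewrite eq_sym (adj_neq vp).
Qed.

Lemma card_contract G v p : v \in vset G ->
  #|vset G| = #|vset (contract G v p)|.+1.
Proof. by move=> vV; rewrite (cardsD1 v) vV. Qed.

(** A small cut of the contraction that misses [p] lifts to the same cut of [G], with [v] on the
    side of [p]; one that contains [p] becomes, together with [v], a cut through [v] and [p]. *)
Lemma contract_conn3 G v p : conn3 G -> adj G v p -> 4 < #|vset G| ->
  ~~ cut_through G v p -> conn3 (contract G v p).
Proof.
move=> c3G vp V5 ncut; split.
  by move: V5; rewrite (card_contract p (adj_vset vp)); clear; lia.
move=> X K x y XV clX xX xK; rewrite !inE => /andP[yv yV] yX yK.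
have vX : v \notin X by apply/negP => /(subsetP XV); rewrite !inE eqxx.
have XV' : X \subset vset G by apply: subset_trans XV (subsetDl _ _).
have pv : p != v by rewrite eq_sym (adj_neq vp).
rewrite ltnNge; apply/negP => K2.
have stepX u w : u \in X -> adj G u w -> w != v -> w \notin X -> w \in K.
  move=> uX uw wv; apply: (clX u) => //; apply: adj_contract_old => //.
  by apply: contraNneq vX => <-.
have [pX|pX] := boolP (p \in X).
  apply: (@conn3_use _ G (v |: X) K x y c3G) => //.
  - by rewrite subUset sub1set (adj_vset vp).
  - move=> u w; rewrite !in_setU1 negb_or => + uw /andP[wv wX].
    case/orP=> [/eqP uv|uX]; last exact: (stepX u).
    apply: (clX p) => //; apply: adj_contract_new => //; first by rewrite -uv.
    by apply: contraNneq wX => ->.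
  - by rewrite in_setU1 xX orbT.
  - by rewrite in_setU1 negb_or yv.
have [pK|pK] := boolP (p \in K); last first.
  apply: (@conn3_use _ G X K x y c3G) => //.
  move=> u w uX uw wX; apply: (stepX u) => //; apply: contraNneq pK => wv.
  have vu : adj G v u by rewrite adjC -wv.
  apply: (clX u) => //; rewrite adjC; apply: adj_contract_new => //.
  by apply: contraNneq pX => <-.
case/negP: ncut; have [t tE] : exists t, K :\ p \subset [set t].
  have K1 : #|K :\ p| <= 1 by have := cardsD1 p K; rewrite pK; move: K2; clear; lia.
  have [->|[t tK]] := set_0Vmem (K :\ p); first by exists v; apply: sub0set.
  by exists t; apply/subsetP => u uK; rewrite inE (card_le1_eqP K1 u t).
(* If [K] contains nothing besides [p], the third vertex defaults to [v]. *)
apply/existsP; exists (if t \in K :\ p then t else v).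
set t' := if _ then _ else _.
have t'K : t' = v \/ t' \in K by rewrite /t'; case: ifP => [|_]; [rewrite inE => /andP[_]; right|left].
have KE u : u \in K -> (u == p) || (u == t').
  move=> uK; case: eqVneq => //= up; have uK' : u \in K :\ p by rewrite !inE up.
  by have := subsetP tE u uK'; rewrite inE /t' => /eqP <-; rewrite uK'.
apply/existsP; exists (X :\: K); apply/and5P; split.
- exact: subset_trans (subsetDl _ _) XV'.
- rewrite disjoint_sym disjoints_subset; apply/subsetP => u; rewrite !inE negb_and negbK.
  case/orP=> [/orP[/eqP->|/eqP->]|/eqP->]; rewrite ?pK ?vX ?orbT //.
  by case: t'K => ->; rewrite ?vX ?orbT.
- by apply/set0Pn; exists x; rewrite inE xK.
- apply/set0Pn; exists y; rewrite !inE (negbTE yX) andbF yV andbT orFb !negb_or yv /=.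
  apply/andP; split; first by apply: contraNneq yK => ->.
  by case: t'K => [->//|t'K]; apply: contraNneq yK => ->.
apply/forall_inP => u; rewrite inE => /andP[uK uX]; apply/subsetP => w; rewrite nbrE => uw.
rewrite !inE; have [->|wv] := eqVneq w v; first by rewrite orbT.
case wK: (w \in K) => /=; first exact: KE.
by apply/orP; left; apply: contraFT wK => wX; apply: (stepX u).
Qed.

(** If [v] lies in [X], it is left out. If [v] lies in [S] and [p] in [X], then [p] takes the place
    of [v] in [S]. If [v] lies in [S] and [p] is [b], then [v] has a second neighbour on the far
    side, hence exactly one neighbour [w] in [X], and [w] takes its place. The lower bound on
    [#|X'|] is what keeps hubs alive in [hub_step]. *)
Lemma persist_core G v p a b X S : conn3 G -> deg G v = 3 -> adj G v p ->
  ~~ cut_through G v p -> v != a -> v != b -> sep G a b X S ->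
  1 < #|X| -> 1 < #|far G X S| ->
  [|| v \in X, (v \in S) && (p \in X) && (p != a) | (v \in S) && (p == b)] ->
  exists X' S', [/\ sep (contract G v p) a b X' S', X' \subset X,
    S' \subset X :|: S &
    nbr G v \subset high G -> (v \in X -> 2 < #|X|) -> 1 < #|X'|].
Proof.
move=> c3G dv vp ncut va vb sp X2 Y2 hyp.
case/and5P: (sp) => aX + XV dXS /andP[S2 _].
rewrite !inE negb_or => /andP[/andP[bX bS] bV].
have aS : a \notin S by rewrite (disjointFr dXS).
have sa := sep_adj sp.
have vV := adj_vset vp; have pV := adj_vsetr vp.
have aV := subsetP XV _ aX.
have lowdeg u : u \in X -> u != a -> X \subset [set a; u] -> deg G u <= 3.
  move=> uX ua XE; have : nbr G u \subset a |: S.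
    apply/subsetP => y; rewrite nbrE in_setU1 => uy.
    have [yX|yX] := boolP (y \in X).
      have := subsetP XE y yX; rewrite !inE => /orP[->//|/eqP yu].
      by move: uy; rewrite yu adj_irr.
    have [yS|yS] := boolP (y \in S); first by rewrite orbT.
    by have [ua' _] := sa u y uy uX yX yS; rewrite ua' eqxx in ua.
  by move/deg_le; rewrite cardsU1 aS; move: S2; clear; lia.
have X1 u : u \in X -> u != a -> #|X :\ u| <= 1 -> X \subset [set a; u].
  move=> uX ua Xu1; apply/subsetP => y yX; rewrite !inE.
  have [->|yu] := eqVneq y u; first by rewrite orbT.
  by rewrite orbF (card_le1_eqP Xu1 y a) // !inE ?yu // eq_sym ua.
case/or3P: hyp.
- move=> vX; exists (X :\ v), S; split.
  + apply: sep_intro.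
    * by rewrite !inE eq_sym va.
    * by rewrite !inE eq_sym vb.
    * by rewrite !inE negb_and bX orbT.
    * exact: bS.
    * exact: setSD.
    * by apply: disjointWl dXS; apply: subsetDl.
    * exact: S2.
    move=> x y; rewrite !inE negb_and negbK => /andP[xv xX] yX yS /adj_contract[_ yv _].
    rewrite (negbTE yv) /= in yX; case=> [xy|[_ vy]|[yp _]]; first exact: sa.
      by have [ve _] := sa _ _ vy vX yX yS; rewrite ve eqxx in va.
    by move: yX yS va; rewrite yp => pX pS; have [-> _] := sa _ _ vp vX pX pS; rewrite eqxx.
  + exact: subsetDl.
  + exact: subsetUr.
  by move=> _ /(_ vX); rewrite (cardsD1 v X) vX; clear; lia.
- case/andP=> /andP[vS pX] pa.
  have vX : v \notin X by apply: contraTN vS => vX; rewrite (disjointFr dXS vX).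
  exists (X :\ p), (p |: S :\ v); split.
  + apply: sep_intro.
    * by rewrite !inE eq_sym pa.
    * by rewrite !inE eq_sym vb.
    * by rewrite !inE negb_and bX orbT.
    * by rewrite !inE negb_or (negbTE bS) andbF andbT; apply: contraNneq bX => ->.
    * by apply/subsetP => x; rewrite !inE => /andP[_ xX]; rewrite (subsetP XV) // andbT;
        apply: contraNneq vX => <-.
    * rewrite disjoints_subset; apply/subsetP => x; rewrite !inE => /andP[xp xX].
      by rewrite (negbTE xp) (disjointFr dXS xX) andbF.
    * rewrite cardsU1; have := cardsD1 v S; rewrite vS; move: S2; clear; lia.
    move=> x y; rewrite !inE negb_and negbK negb_or => /andP[xp xX] yX /andP[yp].
    rewrite (negbTE yp) /= in yX; move=> yS /adj_contract[_ yv _].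
    rewrite yv /= in yS; case=> [xy|[xe _]|[ye _]]; first exact: sa.
      by rewrite xe eqxx in xp.
    by rewrite ye eqxx in yp.
  + exact: subsetDl.
  + by apply/subsetP => x; rewrite !inE => /orP[/eqP->|/andP[_ ->]]; rewrite ?pX ?orbT.
  move=> Nv _; rewrite ltnNge; apply/negP => Xp1.
  have := subsetP Nv p; rewrite nbrE vp inE => /(_ isT).
  by have := lowdeg p pX pa (X1 p pX pa Xp1); clear; lia.
case/andP=> vS /eqP pb; subst p.
have vX : v \notin X by apply: contraTN vS => vX; rewrite (disjointFr dXS vX).
have S1 : #|S :\ v| <= 1 by have := cardsD1 v S; rewrite vS; move: S2; clear; lia.
have [y1] : exists2 y1, y1 \in far G X S :\ b & adj G v y1.
  have [/exists_inP//|none] := boolP [exists y in far G X S :\ b, adj G v y]; exfalso.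
  apply: (@conn3_closed _ G (far G X S :\ b) (b |: S :\ v) c3G).
  + by apply: subset_trans (subsetDl _ _) (subsetDl _ _).
  + move=> y u; rewrite !inE !negb_or => /andP[yb /andP[/andP[yX yS] yV]] yu.
    case: eqVneq => //= ub; rewrite (adj_vsetr yu) andbT negb_and !negbK.
    have [uX|uX] := boolP (u \in X).
      by rewrite adjC in yu; have [_ ye] := sa _ _ yu uX yX yS; rewrite ye eqxx in yb.
    move=> /= uS; rewrite uS andbT; apply: contraNneq none => uv.
    by apply/exists_inP; exists y; rewrite ?(adjC G v) -?uv // !inE negb_or yb yX yS yV.
  + by rewrite cardsU1; move: S1; clear; lia.
  + apply/set0Pn; have [y yY yb] : exists2 y, y \in far G X S & y \notin [set b].
      by apply/subsetPn/negP => /subset_leq_card; rewrite cards1; move: Y2; clear; lia.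
    by exists y; rewrite in_setD1 yY andbT; rewrite inE in yb.
  apply/set0Pn; exists a; rewrite !inE aX aV (negbTE aS) !andbF !orbF andbT /=.
  by apply: contraNneq bX => <-.
rewrite !inE negb_or => /andP[y1b /andP[/andP[y1X y1S] y1V]] vy1.
have [w wX vw] : exists2 w, w \in X & adj G v w.
  have [/exists_inP//|none] := boolP [exists w in X, adj G v w]; exfalso.
  apply: (@conn3_closed _ G X (b |: S :\ v) c3G) => //.
  + move=> x u xX xu uX; rewrite !inE.
    have [uS|uS] := boolP (u \in S); last by have [_ ->] := sa _ _ xu xX uX uS; rewrite eqxx.
    apply/orP; right; rewrite andbT; apply: contraNneq none => uv.
    by apply/exists_inP; exists x; rewrite ?(adjC G v) -?uv.
  + by rewrite cardsU1; move: S1; clear; lia.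
  + by apply/set0Pn; exists a.
  apply/set0Pn; exists y1; rewrite !inE y1V (negbTE y1X) (negbTE y1S) (negbTE y1b).
  by rewrite andbF.
have NvX x : x \in X -> adj G v x -> x = w.
  move=> xX vx; apply: contra_eq dv => xw.
  have /subset_leq_card : [set b; y1; w; x] \subset nbr G v.
    by rewrite !subUset !sub1set !nbrE vp vy1 vw vx.
  have bw : b != w by apply: contraNneq bX => ->.
  have bx : b != x by apply: contraNneq bX => ->.
  have yw : y1 != w by apply: contraNneq y1X => ->.
  have yx : y1 != x by apply: contraNneq y1X => ->.
  rewrite -!setUA !cardsU1 cards1 !inE !negb_or (eq_sym b y1) y1b bw bx yw yx.
  rewrite (eq_sym w) xw /= /deg; clear; lia.
(* Otherwise [a] and the rest of [S] would cut off [X :\ a]. *)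
have wa : w != a.
  apply/eqP => wa; subst w.
  apply: (@conn3_closed _ G (X :\ a) (a |: S :\ v) c3G).
  + exact: subset_trans (subsetDl _ _) XV.
  + move=> x u; rewrite !inE negb_and negbK => /andP[xa xX] xu.
    case: eqVneq => //= ua uX; have [uS|uS] := boolP (u \in S); last first.
      by have [xe _] := sa _ _ xu xX uX uS; rewrite xe eqxx in xa.
    rewrite andbT; apply: contraNneq xa => uv; apply/eqP; apply: NvX => //.
    by rewrite adjC -uv.
  + by rewrite cardsU1; move: S1; clear; lia.
  + apply/set0Pn; have [y yX ya] : exists2 y, y \in X & y \notin [set a].
      by apply/subsetPn/negP => /subset_leq_card; rewrite cards1; move: X2; clear; lia.
    by exists y; rewrite in_setD1 yX andbT; rewrite inE in ya.
  apply/set0Pn; exists b; rewrite !inE bV (negbTE bX) (negbTE bS) !andbF /= orbF andbT.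
  by apply: contraNneq bX => ->.
exists (X :\ w), (w |: S :\ v); split.
- apply: sep_intro.
  + by rewrite !inE eq_sym wa.
  + by rewrite !inE eq_sym vb.
  + by rewrite !inE negb_and bX orbT.
  + by rewrite !inE negb_or (negbTE bS) andbF andbT; apply: contraNneq bX => ->.
  + by apply/subsetP => x; rewrite !inE => /andP[_ xX]; rewrite (subsetP XV) // andbT;
      apply: contraNneq vX => <-.
  + rewrite disjoints_subset; apply/subsetP => x; rewrite !inE => /andP[xp xX].
    by rewrite (negbTE xp) (disjointFr dXS xX) andbF.
  + by rewrite cardsU1; move: S1; clear; lia.
  move=> x y; rewrite !inE negb_and negbK negb_or => /andP[xw xX] yX /andP[yw].
  rewrite (negbTE yw) /= in yX; move=> yS /adj_contract[_ yv _].
  rewrite yv /= in yS; case=> [xy|[xe _]|[ye vx]]; first exact: sa.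
    by move: bX; rewrite -xe xX.
  by rewrite (NvX x xX vx) eqxx in xw.
- exact: subsetDl.
- by apply/subsetP => x; rewrite !inE => /orP[/eqP->|/andP[_ ->]]; rewrite ?wX ?orbT.
move=> Nv _; rewrite ltnNge; apply/negP => Xw1.
have := subsetP Nv w; rewrite nbrE vw inE => /(_ isT).
by have := lowdeg w wX wa (X1 w wX wa Xw1); clear; lia.
Qed.

(** If [persist_core] applies to neither side, then [S] consists of [v] and [p], and adding [a] to
    it gives a cut through [v] and [p]. *)
Lemma persist G v p a b X S : conn3 G -> deg G v = 3 -> adj G v p ->
  ~~ cut_through G v p -> v != a -> v != b -> sep G a b X S ->
  1 < #|X| -> 1 < #|far G X S| ->
  exists X' S', sep (contract G v p) a b X' S' /\
    (nbr G v \subset high G -> (v \in X -> 2 < #|X|) -> 1 < #|X'|).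
Proof.
move=> c3G dv vp ncut va vb sp X2 Y2.
case/and5P: (sp) => aX bF XV dXS /andP[S2 _].
have [bV bX bS] : [/\ b \in vset G, b \notin X & b \notin S].
  by move: bF; rewrite !inE negb_or => /andP[/andP[-> ->] ->].
have vV := adj_vset vp; have pV := adj_vsetr vp.
have [H|H] := boolP [|| v \in X, (v \in S) && (p \in X) && (p != a) | (v \in S) && (p == b)].
  by have [X' [S' [sp' _ _ H']]] := persist_core c3G dv vp ncut va vb sp X2 Y2 H; exists X', S'.
move: H; rewrite !negb_or => /and3P[vX H1 H2].
have X2' : 1 < #|far G (far G X S) S|.
  apply: leq_trans X2 _; apply: subset_leq_card; apply/subsetP => x xX.
  by rewrite !inE xX (subsetP XV) // (disjointFr dXS).
have [H|H] := boolP [|| v \in far G X S, (v \in S) && (p \in far G X S) && (p != b) | (v \in S) && (p == a)].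
  have [X' [S' [sp' XX' SS' _]]] := persist_core c3G dv vp ncut vb va (sepC sp) Y2 X2' H.
  (* The far side was shrunk, so the complementary side contains all of [X]. *)
  exists (far (contract G v p) X' S'), S'; split; first exact: sepC.
  move=> _ _; apply: leq_trans X2 _; apply: subset_leq_card; apply/subsetP => x xX.
  rewrite !inE (subsetP XV) // andbT negb_or; apply/andP; split; last by apply: contraNneq vX => <-.
  apply/andP; split; first by apply: contraTN xX => /(subsetP XX'); rewrite !inE; case: (x \in X).
  apply: contraTN xX => /(subsetP SS'); rewrite !inE.
  by case: (x \in X) (disjointFr dXS : x \in X -> _) => //= /(_ isT)->.
move: H; rewrite !negb_or => /and3P[vY H3 H4].
have vS : v \in S by move: vY; rewrite !inE vV (negbTE vX) /= andbT negbK.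
rewrite vS /= in H1 H2 H3 H4.
have pS : p \in S.
  apply: contraNT H3 => pS; rewrite !inE H2 negb_or pS pV !andbT.
  by apply: contraNN H1 => ->.
have vp' := adj_neq vp.
have S_eq := set2_eq S2 vS pS vp'.
case/negP: ncut; apply/existsP; exists a; apply/existsP; exists (X :\ a).
apply/and5P; split.
- exact: subset_trans (subsetDl _ _) XV.
- rewrite disjoints_subset; apply/subsetP => x; rewrite !inE => /andP[xa xX].
  have := disjointFr dXS xX; rewrite S_eq !inE => ->; by rewrite (negbTE xa).
- apply/set0Pn; have [y yX ya] : exists2 y, y \in X & y \notin [set a].
    by apply/subsetPn/negP => /subset_leq_card; rewrite cards1; move: X2; clear; lia.
  by exists y; rewrite in_setD1 yX andbT; rewrite inE in ya.
- apply/set0Pn; exists b; rewrite !inE (negbTE bX) andbF bV andbT /=.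
  by move: bS; rewrite S_eq !inE negb_or => /andP[/negbTE-> /negbTE->] /=; apply: contraNneq bX => ->.
apply/forall_inP => x; rewrite !inE => /andP[xa xX]; apply/subsetP => y; rewrite nbrE => xy.
rewrite !inE; have [ya|ya] := eqVneq y a; first by rewrite !orbT.
have [//|yX] := boolP (y \in X); have [|yS] := boolP (y \in S).
  by rewrite S_eq !inE orbF => ->.
by have [xe _] := sep_adj sp xy xX yX yS; rewrite xe eqxx in xa.
Qed.

End Contract.

(** * Hubs *)

Section Reduction.
Context {T : finType}.
Implicit Types (G : sgraph T) (X Y Z K S P Q R D : {set T}) (h : rel T).

(* The separation encodes a 3-cut through the hub [v]: removing [v |: S] separates
   [X :\ v] from [far G X S]. *)
Definition hubs G :=
  [set v | [&& deg G v == 3, nbr G v \subset high G &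
     [exists w in nbr G v, exists X : {set T}, exists S : {set T},
        sep G v w X S && (1 < #|X|)]]].

(** Read as a number, one guaranteed unit of degree beyond [4 * #|high G|]. *)
Definition excess G : bool := [exists x in high G, 4 < deg G x].

Lemma hubsP G v : reflect
  [/\ deg G v = 3, nbr G v \subset high G &
    exists w X S, [/\ adj G v w, sep G v w X S & 1 < #|X|]]
  (v \in hubs G).
Proof.
rewrite inE; apply: (iffP and3P) => -[].
  move=> /eqP dv Nv /exists_inP[w]; rewrite nbrE => vw /existsP[X /existsP[S /andP[sp X2]]].
  by split => //; exists w, X, S.
move=> dv Nv [w [X [S [vw sp X2]]]]; split; rewrite ?dv //.
apply/exists_inP; exists w; rewrite ?nbrE //.
by apply/existsP; exists X; apply/existsP; exists S; rewrite sp.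
Qed.

Lemma sum_deg G : 4 * #|high G| + excess G <= \sum_(x in high G) deg G x.
Proof.
have F4 x : x \in high G -> 4 <= deg G x by rewrite inE.
case ex: (excess G); last first.
  rewrite addn0 mulnC -sum_nat_const; exact: leq_sum.
case/exists_inP: ex => x xF dx.
rewrite (big_setD1 x) //= (cardsD1 x) xF.
have : #|high G :\ x| * 4 <= \sum_(i in high G :\ x) deg G i.
  by rewrite -sum_nat_const; apply: leq_sum => i; rewrite inE => /andP[_ /F4].
by move: dx; clear; lia.
Qed.

Lemma wdeg_sum G : \sum_(x in high G) deg G x =
  \sum_(x in high G) sdeg G x + \sum_(x in high G) wdeg G x.
Proof. by rewrite -big_split; apply: eq_bigr => x _; apply: deg_split. Qed.

Lemma low_bound G v : conn3 G -> deg G v = 3 ->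
  2 * #|high G| + 2 * #|nbr G v :&: high G| + excess G <=
  \sum_(x in high G) wdeg G x.
Proof.
move=> c3G dv; have := count_low c3G dv; have := sum_deg G; rewrite wdeg_sum.
by clear; lia.
Qed.

Lemma sep_large G a b X S : sep G a b X S -> 3 < deg G a -> 1 < #|X|.
Proof.
move=> sp da; case/and5P: (sp) => aX _ _ _ /andP[S2 _].
rewrite ltnNge; apply/negP => X1.
have : nbr G a \subset b |: S.
  apply/subsetP => y; rewrite nbrE in_setU1 => ay.
  have yX : y \notin X.
    by apply/negP => yX; move: ay; rewrite (card_le1_eqP X1 y a yX aX) adj_irr.
  have [//|yS] := boolP (y \in S); first by rewrite orbT.
  by have [_ ->] := sep_adj sp ay aX yX yS; rewrite eqxx.
by move/deg_le; rewrite cardsU1; move: S2 da; clear; lia.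
Qed.

Lemma persist_high G v p a b : conn3 G -> deg G v = 3 -> adj G v p ->
  ~~ cut_through G v p -> a \in high G -> b \in high G -> sepable G a b ->
  sepable (contract G v p) a b.
Proof.
move=> c3G dv vp nc; rewrite !inE => da db /sepableP[X [S sp]].
have [X' [S' [sp' _]]] : exists X' S', sep (contract G v p) a b X' S' /\
    (nbr G v \subset high G -> (v \in X -> 2 < #|X|) -> 1 < #|X'|).
  apply: (persist c3G dv vp nc _ _ sp).
  - by apply: contraTneq da => <-; rewrite dv.
  - by apply: contraTneq db => <-; rewrite dv.
  - exact: sep_large sp da.
  - exact: sep_large (sepC sp) db.
by apply/sepableP; exists X', S'.
Qed.

(** The only edge between [v] and [A] ends in [w]; the contraction turns it into [wp], which then is
    the only edge across. *)
Lemma sep_contract G v w p (A S : {set T}) : adj G v p -> A \subset vset G ->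
  v \notin A -> w \in A -> p \notin A -> p \notin S -> [disjoint A & S] ->
  #|S| <= 2 -> (forall x y, x \in A -> adj G x y -> [|| y \in A, y \in S | y == v]) ->
  (forall x, x \in A -> adj G v x -> x = w) ->
  sep (contract G v p) w p A S.
Proof.
move=> vp AV vA wA pA pS dAS S2 clA vAw; apply: sep_intro => //.
- by rewrite !inE eq_sym (adj_neq vp) (adj_vsetr vp).
- apply/subsetP => x xA; rewrite !inE (subsetP AV) // andbT.
  by apply: contraNneq vA => <-.
move=> x y xA yA yS /adj_contract[_ yv _] [xy|[xp _]|[-> vx]].
- by have := clA x y xA xy; rewrite (negbTE yA) (negbTE yS) (negbTE yv).
- by move: pA; rewrite -xp xA.
by rewrite (vAw x xA vx).
Qed.

Lemma hub_contract G v : conn3 G -> v \in hubs G -> exists w p q,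
  [/\ adj G v w, adj G v p, adj G v q & nbr G v = [set w; p; q]] /\
  [/\ w != p, w != q, p != q & ~~ adj G w p] /\
  ~~ cut_through G v p /\ sepable (contract G v p) w p.
Proof.
move=> c3G /hubsP[dv NF [w [X [S [vw sp X2]]]]].
case/and5P: (sp) => vX wF XV dXS /andP[S2 _].
have [wV wX wS] : [/\ w \in vset G, w \notin X & w \notin S].
  by move: wF; rewrite !inE negb_or => /andP[/andP[-> ->] ->].
have vS : v \notin S by rewrite (disjointFr dXS).
have NvE y : adj G v y -> [|| y \in X, y \in S | y == w].
  move=> vy; case yX: (y \in X) => //=; case yS: (y \in S) => //=.
  by have [_ ->] := sep_adj sp vy vX (negbT yX) (negbT yS).
have big y : adj G v y -> 3 < deg G y.
  by move=> vy; have := subsetP NF y; rewrite nbrE vy inE => ->.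
have [p0 p0X vp0] : exists2 p, p \in X & adj G v p.
  have [/exists_inP//|none] := boolP [exists p in X, adj G v p]; exfalso.
  apply: (@conn3_closed _ G (X :\ v) S c3G) => //.
  - exact: subset_trans (subsetDl _ _) XV.
  - move=> x y; rewrite !inE negb_and negbK => /andP[xv xX] xy /orP[/eqP yv|yX].
      by case: (negP none); apply/exists_inP; exists x; rewrite // adjC -yv.
    apply: contraNT xv => yS; apply/eqP.
    by case: (sep_adj sp xy xX yX yS).
  - by apply/set0Pn; have [y yX yv] : exists2 y, y \in X & y \notin [set v];
      [apply/subsetPn/negP => /subset_leq_card; rewrite cards1; move: X2; clear; lia
      | exists y; rewrite in_setD1 yX andbT; rewrite inE in yv].
  by apply/set0Pn; exists w; rewrite !inE (negbTE wX) (negbTE wS) andbF wV.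
have p0w : p0 != w by apply: contraNneq wX => <-.
have [q0 vq0 /andP[q0p q0w]] : exists2 q, adj G v q & (q != p0) && (q != w).
  have [q] : exists2 q, q \in nbr G v & q \notin [set p0; w].
    by apply/subsetPn/negP => /deg_le; rewrite dv cards2; case: (_ != _).
  by rewrite nbrE !inE negb_or; exists q.
have Nv : nbr G v = [set w; p0; q0].
  apply/esym/eqP; rewrite eqEcard !subUset !sub1set !nbrE vw vp0 vq0 /=.
  rewrite -/(deg G v) dv -setUA !cardsU1 cards1 !inE negb_or.
  by rewrite (eq_sym w p0) p0w (eq_sym w q0) q0w (eq_sym p0 q0) q0p.
have Yw p : p \in X -> adj G v p -> ~~ adj G w p /\ sepable (contract G v p) w p.
  move=> pX vp; have clY x y : x \in far G X S -> adj G x y ->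
      [|| y \in far G X S, y \in S | y == v].
    move=> xY xy; rewrite inE in_setU (adj_vsetr xy) andbT.
    have [yX|yX] := boolP (y \in X); last by case: (y \in S); rewrite ?orbT.
    have xX : x \notin X by move: xY; rewrite !inE; case: (x \in X).
    have xS : x \notin S by move: xY; rewrite !inE; case: (x \in S); rewrite ?orbT.
    rewrite adjC in xy; have [-> _] := sep_adj sp xy yX xX xS.
    by rewrite eqxx !orbT.
  have pv : p != v by rewrite eq_sym (adj_neq vp).
  have pY : p \notin far G X S by rewrite !inE pX.
  have pS : p \notin S by rewrite (disjointFr dXS).
  split.
    apply/negP => wp; have := clY w p wF wp.
    by rewrite (negbTE pY) (negbTE pS) (negbTE pv).
  apply/sepableP; exists (far G X S), S; apply: sep_contract => //.
  - exact: subsetDl.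
  - by rewrite !inE vX.
  - by rewrite disjoints_subset; apply/subsetP => y; rewrite !inE negb_or => /andP[/andP[_ ->]].
  move=> x xY vx; have := NvE x vx; move: xY; rewrite !inE negb_or.
  by case/andP=> /andP[/negbTE-> /negbTE->] _ /= /eqP.
(* The choice is [p0] unless a cut passes through [v] and [p0]. In that case [one_cut_through] frees
   the other neighbours: [q0] is chosen if it lies in [X]; otherwise [p0] is the only neighbour of
   [v] in [X], so [w] and [p0] exchange roles and the hub is contracted into [w]. *)
have [c0|c0] := boolP (cut_through G v p0); last first.
  have [H1 H2] := Yw p0 p0X vp0; exists w, p0, q0.
  by rewrite !(eq_sym w) (eq_sym p0 q0); split.
have [q0X|q0X] := boolP (q0 \in X).
  have [H1 H2] := Yw q0 q0X vq0; exists w, q0, p0.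
  rewrite !(eq_sym w) Nv setUAC; split => //; split => //; split => //.
  apply/negP => c1; apply: (@one_cut_through _ G v w q0 p0 c3G) => //.
  - by rewrite Nv setUAC.
  - by rewrite eq_sym.
  - by rewrite eq_sym.
  exact: big.
have q0S : q0 \in S by have := NvE q0 vq0; rewrite (negbTE q0X) (negbTE q0w) orbF.
have clX x y : x \in X :\ v -> adj G x y -> [|| y \in X :\ v, y \in S | y == v].
  rewrite !inE => /andP[xv xX] xy; case: eqVneq => //= yv; rewrite ?orbT // orbF.
  apply: contraNT xv; rewrite negb_or => /andP[yX yS].
  by have [-> _] := sep_adj sp xy xX yX yS; rewrite eqxx.
have wXv : w \notin X :\ v by rewrite !inE negb_and wX orbT.
have wv : w != v by rewrite eq_sym (adj_neq vw).
have p0Xv : p0 \in X :\ v by rewrite !inE p0X eq_sym (adj_neq vp0).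
exists p0, w, q0; split; first by rewrite Nv (setUC [set w]).
rewrite (eq_sym p0 q0) (eq_sym w q0); split; first split => //.
  by apply/negP => pw; have := clX p0 w p0Xv pw; rewrite (negbTE wXv) (negbTE wS) (negbTE wv).
split.
  apply/negP => c1; apply: (@one_cut_through _ G v q0 w p0 c3G) => //.
  - by rewrite Nv; apply/subsetP => y; rewrite !inE -!orbA => /or3P[]->; rewrite ?orbT.
  - by rewrite eq_sym.
  exact: big.
apply/sepableP; exists (X :\ v), S; apply: sep_contract => //.
- exact: subset_trans (subsetDl _ _) XV.
- by rewrite !inE eqxx.
- by apply: disjointWl dXS; apply: subsetDl.
move=> x; rewrite !inE => /andP[xv xX] vx.
have : x \in nbr G v by rewrite nbrE.
rewrite Nv !inE => /orP[/orP[]|] /eqP // xe; first by rewrite -xe xX in wX.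
by rewrite -xe xX in q0X.
Qed.

End Reduction.

(** * Contracting a hub *)

Section Step.
Context {T : finType}.
Variables (G : sgraph T) (v w p q : T).
Hypotheses (c3G : conn3 G) (dv : deg G v = 3) (NF : nbr G v \subset high G).
Hypotheses (vw : adj G v w) (vp : adj G v p) (vq : adj G v q).
Hypotheses (Nv : nbr G v = [set w; p; q]).
Hypotheses (wp : w != p) (wq : w != q) (pq : p != q) (wNp : ~~ adj G w p).
Hypotheses (nc : ~~ cut_through G v p) (swp : sepable (contract G v p) w p).

Let H := contract G v p.
Let F := high G.
Let F' := high H.

Let bigN y : adj G v y -> y \in F.
Proof. by move=> vy; apply: (subsetP NF); rewrite nbrE. Qed.

Let vF : v \notin F. Proof. by rewrite inE dv. Qed.

Let adjv y : adj G v y = [|| y == w, y == p | y == q].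
Proof. by rewrite -nbrE Nv !inE orbA. Qed.

Let vw' := adj_neq vw. Let vp' := adj_neq vp. Let vq' := adj_neq vq.

Lemma nbr_step x : x != v -> x != p -> ~~ adj G v x -> nbr H x = nbr G x.
Proof. by move=> xv xp vx; rewrite nbr_contract // (negbTE vx). Qed.

Lemma nbr_step_wq x : x != p -> adj G v x -> nbr H x = p |: (nbr G x :\ v).
Proof. by move=> xp vx; rewrite nbr_contract // ?vx // eq_sym (adj_neq vx). Qed.

Lemma nbr_step_p : nbr H p = w |: (q |: (nbr G p :\ v)).
Proof.
rewrite nbr_contract_p // Nv; apply/setP => y; rewrite !inE.
case: (eqVneq y w) => [->|yw] /=; first by rewrite wp orbT.
case: (eqVneq y q) => [->|yq] /=; first by rewrite (eq_sym q p) pq !orbT.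
by rewrite orbF andNb orbF.
Qed.

Lemma deg_step x : x != v -> x != p -> ~~ adj G v x -> deg H x = deg G x.
Proof. by move=> *; rewrite /deg nbr_step. Qed.

Lemma deg_step_wq x : x != p -> adj G v x -> deg H x + adj G x p = deg G x.
Proof.
move=> xp vx; rewrite /deg nbr_step_wq // cardsU1 !inE eq_sym vp' /=.
have := cardsD1 v (nbr G x); rewrite nbrE adjC vx.
case: (adj G x p); clear; lia.
Qed.

Lemma deg_step_p : deg H p = deg G p + ~~ adj G p q.
Proof.
rewrite /deg nbr_step_p !cardsU1 !inE !(eq_sym _ v) vw' vq' (negbTE wq) /=.
rewrite (adjC G p w) (negbTE wNp) /=.
have := cardsD1 v (nbr G p); rewrite nbrE adjC vp; case: (adj G p q); clear; lia.
Qed.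

Lemma deg_step_v : deg H v = 0.
Proof.
apply/eqP; rewrite cards_eq0; apply/eqP/setP => y; rewrite nbrE inE.
by apply/negP => /adj_contract[]; rewrite eqxx.
Qed.

Lemma deg_step_ge x : x != v -> x != q -> deg G x <= deg H x.
Proof.
move=> xv xq; have [->|xp] := eqVneq x p; first by rewrite deg_step_p leq_addr.
have [vx|vx] := boolP (adj G v x); last by rewrite deg_step.
have xw : x = w by move: vx; rewrite adjv (negbTE xp) (negbTE xq) !orbF => /eqP.
by rewrite -(deg_step_wq xp vx) xw (negbTE wNp) addn0.
Qed.

Lemma step_sub : F' \subset F.
Proof.
apply/subsetP => x xF'; have [vx|vx] := boolP (adj G v x); first exact: bigN.
have xv : x != v by apply: contraTneq xF' => ->; rewrite inE deg_step_v.
have xp : x != p by apply: contraNneq vx => ->.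
by move: xF'; rewrite !inE deg_step.
Qed.

Lemma step_high x : x \in F -> x != q -> x \in F'.
Proof.
move=> xF xq; have xv : x != v by apply: contraTneq xF => ->.
by move: xF; rewrite !inE => xF; apply: leq_trans xF (deg_step_ge xv xq).
Qed.

Lemma pF' : p \in F'. Proof. by apply: step_high => //; apply: bigN. Qed.
Lemma wF' : w \in F'. Proof. by apply: step_high => //; apply: bigN. Qed.

Lemma triangle_pq : sepable G p q -> adj G p q -> False.
Proof.
move=> s apq; have := triangle_low c3G dv (bigN vp) (bigN vq) vp vq apq.
by rewrite s.
Qed.

Lemma triangle_wq : sepable G w q -> adj G w q -> False.
Proof.
move=> s awq; have := triangle_low c3G dv (bigN vw) (bigN vq) vw vq awq.
by rewrite s.
Qed.

(** If [q] is no longer high, a separable edge [xq] becomes a weak one; [bonus] counts this. *)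
Let Q1 x := [set y | (y == q) && (q \notin F') && (adj G x q && sepable G x q)].

Lemma W_step x : x \in F -> x != p ->
  weak_nbr H x \subset (weak_nbr G x :\ v) :|: Q1 x :|: [set y | (y == p) && (x == q) ].
Proof.
move=> xF xp; apply/subsetP => y; rewrite inE => /andP[xy ns].
have /adj_contract[xv yv _ [xy'|[xe]|[yp vx]]] := xy.
- rewrite !inE yv xy' /=.
  case yF: (3 < deg G y) => //=; case sxy: (sepable G x y) => //=.
  have yF1 : y \in F by rewrite inE yF.
  have [yq|yq] := eqVneq y q; last first.
    case/negP: ns; rewrite (step_high yF1 yq) /=; exact: persist_high.
  rewrite -yq xy' sxy andbT /= orbC; apply/orP; right.
  rewrite andbT; apply: contra ns => yF2; rewrite inE yF2 /=; exact: persist_high.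
- by rewrite xe eqxx in xp.
move: vx; rewrite adjv (negbTE xp) orFb => /orP[/eqP xw|/eqP xq].
  by case/negP: ns; rewrite yp pF' xw.
by rewrite !inE yp xq !eqxx !orbT.
Qed.

Lemma W_step_p : weak_nbr H p \subset q |: (weak_nbr G p :\ v).
Proof.
apply/subsetP => y; rewrite inE => /andP[py ns].
have : y \in nbr H p by rewrite nbrE.
rewrite nbr_step_p !inE => /or3P[/eqP yw|->//|/andP[yv py']].
  by case/negP: ns; rewrite yw wF' sepableC.
rewrite yv py' /=; case: eqVneq => //= yq.
apply: contra ns => /andP[yF s]; rewrite step_high ?inE //=.
by apply: persist_high => //; [apply: bigN | rewrite inE].
Qed.

Let bonus x : nat := (q \notin F') && (adj G x q && sepable G x q).

Lemma cardQ1 x : #|Q1 x| = bonus x.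
Proof.
rewrite /bonus; case hb: (_ && _).
  have -> : Q1 x = [set q] by apply/setP => y; rewrite in_set in_set1 -andbA hb andbT.
  by rewrite cards1.
have -> : Q1 x = set0 by apply/setP => y; rewrite in_set in_set0 -andbA hb andbF.
by rewrite cards0.
Qed.

(** Each of [w], [p] and [q] loses the weak neighbour [v]. The new edge [wp] is separable, so [w]
    gains one unit. The edge [pq] may replace the loss at [p] and [q], unless it was there before;
    then it was already weak by [triangle_low], and both gain one unit. *)
Lemma wdeg_step x : x \in F ->
  wdeg H x + (x == w) + (((x == p) || (x == q)) && adj G p q) <= wdeg G x + bonus x.
Proof.
move=> xF; rewrite /wdeg.
have cW : #|weak_nbr G x| = adj G v x + #|weak_nbr G x :\ v|.
  by rewrite (cardsD1 v) in_set (negbTE vF) andbT adjC.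
have [xp|xp] := eqVneq x p.
  subst x; rewrite eq_sym (negbTE wp) vp addn0 in cW *; rewrite cW.
  have := subset_leq_card W_step_p; rewrite cardsU1 !inE eq_sym vq' /=.
  case apq: (adj G p q) => /=; last by clear; lia.
  have -> : sepable G p q = false by apply/negbTE/negP => s; apply: triangle_pq.
  by rewrite andbF /=; clear; lia.
have := subset_leq_card (W_step xF xp).
have [xq|xq] := eqVneq x q.
  have Q0 : bonus x = 0 by rewrite /bonus xq adj_irr andbF.
  have -> : Q1 x = set0 by apply/eqP; rewrite -cards_eq0 cardQ1 Q0.
  subst x; rewrite setU0 eq_sym (negbTE wq) vq in cW *; rewrite cW /=.
  have -> : [set y | (y == p) && true] = [set p].
    by apply/setP => y; rewrite !inE andbT.
  case apq: (adj G p q) => /=.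
    have -> : weak_nbr G q :\ v :|: [set p] = weak_nbr G q :\ v.
      apply/setUidPl; rewrite sub1set !inE eq_sym vp' adjC apq /= sepableC.
      by rewrite andbC; apply/negP => /andP[/triangle_pq/(_ apq)].
    by clear; lia.
  by rewrite cardsU cards1; clear; lia.
have -> : [set y | (y == p) && false] = set0 by apply/setP => y; rewrite !inE andbF.
rewrite setU0 cardsU cardQ1 cW /= addn0 adjv (negbTE xp) (negbTE xq) !orbF.
by clear; lia.
Qed.

(** The degree of [q] falls only when [vq] and [pq] merge, and then by one. *)
Lemma q_drops : q \notin F' -> adj G p q /\ deg G q = 4.
Proof.
move=> qF'; have qF := bigN vq.
have := deg_step_wq _ vq; rewrite eq_sym pq adjC => /(_ isT).
by move: qF qF'; rewrite !inE; case: (adj G p q); clear; lia.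
Qed.

Lemma step_eq : q \in F' -> F' = F.
Proof.
move=> qF'; apply/eqP; rewrite eqEsubset step_sub; apply/subsetP => x xF.
by have [->//|xq] := eqVneq x q; apply: step_high.
Qed.

Lemma step_eqD : q \notin F' -> F' = F :\ q.
Proof.
move=> qF'; apply/setP => x; rewrite in_setD1; apply/idP/andP => [xF'|[xq xF]].
  by split; [apply: contraNneq qF' => <- | apply: (subsetP step_sub)].
exact: step_high.
Qed.

Lemma weight_step : q \in F' ->
  \sum_(x in F') wdeg H x + 1 + 2 * adj G p q <= \sum_(x in F) wdeg G x.
Proof.
move=> qF'; rewrite (step_eq qF').
have hle := @leq_sum _ (index_enum T) (mem F) _ _ (fun x xF => wdeg_step xF).
have {hle} : \sum_(x in F) (wdeg H x + (x == w) + (((x == p) || (x == q)) && adj G p q)) <=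
  \sum_(x in F) (wdeg G x + bonus x) by [].
have -> : \sum_(x in F) (wdeg G x + bonus x) = \sum_(x in F) wdeg G x.
  by apply: eq_bigr => x _; rewrite /bonus qF' addn0.
rewrite !big_split /= (sum_eq1 (bigN vw)).
have -> : \sum_(x in F) (((x == p) || (x == q)) && adj G p q : nat) = 2 * adj G p q.
  rewrite -[2]/(1 + 1) -{1}(sum_eq1 (bigN vp)) -(sum_eq1 (bigN vq)) -big_split big_distrl.
  apply: eq_bigr => x _ /=; case: (eqVneq x p) => [->|_]; rewrite ?(negbTE pq);
  by case: (x == q); case: (adj G p q).
by clear; lia.
Qed.

(** The 6 is one unit each from [w] and [p] plus the four edges at [q], which leaves the sum. Of
    these, [sdeg G q] were not weak, and equally many edges become weak at their other ends. *)
Lemma weight_stepD : q \notin F' ->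
  \sum_(x in F') wdeg H x + 6 <= \sum_(x in F) wdeg G x + 2 * sdeg G q.
Proof.
move=> qF'; have qF := bigN vq; rewrite (step_eqD qF').
have [apq dq] := q_drops qF'.
have hle : \sum_(x in F :\ q) (wdeg H x + (x == w) + (((x == p) || (x == q)) && adj G p q)) <=
  \sum_(x in F :\ q) (wdeg G x + bonus x).
  by apply: leq_sum => x; rewrite !inE => /andP[_ xF]; apply: wdeg_step; rewrite inE.
rewrite [X in _ <= X + _](big_setD1 q) //=.
have := deg_split G q; rewrite dq => dsq.
have bs : \sum_(x in F :\ q) bonus x = sdeg G q.
  rewrite /sdeg -sum1_card [RHS]big_mkcond [LHS]big_mkcond; apply: eq_bigr => x _.
  rewrite /bonus qF' !inE adjC sepableC; case: eqVneq => [->|_] /=.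
    by rewrite adj_irr andbF.
  by case: (3 < _) => //=; case: (_ && _).
move: hle; rewrite !big_split /= bs.
have -> : \sum_(x in F :\ q) (x == w : nat) = 1 by apply: sum_eq1; rewrite in_setD1 wq bigN.
have -> : \sum_(x in F :\ q) (((x == p) || (x == q)) && adj G p q : nat) = 1.
  rewrite -[RHS](@sum_eq1 _ (F :\ q) p); last by rewrite in_setD1 pq bigN.
  by apply: eq_bigr => x; rewrite in_setD1 apq andbT => /andP[/negbTE-> _]; rewrite orbF.
by move: dsq; clear; lia.
Qed.

(** The separation of [u] survives by [persist]. Its side could become too small only if it were [u]
    and [v], but then all three neighbours of [v] would lie in [S]. *)
Lemma hub_step u : u \in hubs G -> u != v -> (q \in F') || ~~ adj G u q -> u \in hubs H.
Proof.
case/hubsP => du Nu [y [X [S [uy sp X2]]]] uv hq.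
have uF : u \notin F by rewrite inE du.
have vu : ~~ adj G v u by apply: contraNN uF => /bigN.
have up : u != p by apply: contraNneq uF => ->; apply: bigN.
have yF : y \in F by apply: (subsetP Nu); rewrite nbrE.
have yv : y != v by apply: contraNneq vF => <-.
apply/hubsP; split; first by rewrite deg_step.
  rewrite nbr_step //; apply/subsetP => z; rewrite nbrE => uz.
  have zF : z \in F by apply: (subsetP Nu); rewrite nbrE.
  have [zq|zq] := eqVneq z q; last exact: step_high.
  by move: hq; rewrite -zq uz orbF.
have Y2 : 1 < #|far G X S| by apply: sep_large (sepC sp) _; move: yF; rewrite inE.
have vu' : v != u by rewrite eq_sym.
have vy' : v != y by rewrite eq_sym.
have [X' [S' [sp' X2']]] := persist c3G dv vp nc vu' vy' sp X2 Y2.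
exists y, X', S'; split => //; first by rewrite -nbrE nbr_step // nbrE.
apply: X2' => // vX; rewrite ltnNge; apply/negP => X2''.
have uX : u \in X by case/and5P: sp.
have XE := set2_eq X2'' uX vX uv.
have : nbr G v \subset S.
  apply/subsetP => z; rewrite nbrE => vz.
  have zX : z \notin X.
    rewrite XE !inE negb_or (eq_sym z v) (adj_neq vz) andbT.
    by apply: contraNneq vu => <-.
  apply/negPn/negP => zS; have [ve _] := sep_adj sp vz vX zX zS.
  by rewrite ve eqxx in uv.
move/deg_le; rewrite dv; case/and5P: sp => _ _ _ _ /andP[S2 _].
by move: S2; clear; lia.
Qed.

(** The neighbours of [q] besides [v] and [p] are then both joined to it by separable edges and
    high, so [q] replaces [v] as a hub. *)
Lemma hub_q : q \notin F' -> sdeg G q = 2 -> q \in hubs H.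
Proof.
move=> qF' sq; have qF := bigN vq.
have [apq dq] := q_drops qF'.
pose A := [set y in F | adj G q y && sepable G q y].
have cA : #|A| = 2 by [].
have AE : A = (nbr G q :\ v) :\ p.
  apply/eqP; rewrite eqEcard cA; apply/andP; split.
    apply/subsetP => y; rewrite !inE => /and3P[yF qy s]; rewrite qy andbT; apply/andP; split.
      apply/negP => /eqP yp; subst y; apply: triangle_pq => //; by rewrite sepableC.
    by apply: contraTneq yF => ->; rewrite dv.
  have := cardsD1 v (nbr G q); rewrite nbrE adjC vq -/(deg G q) dq.
  have := cardsD1 p (nbr G q :\ v); rewrite in_setD1 nbrE (adjC G q p) apq eq_sym vp' /=.
  by clear; lia.
have qp : q != p by rewrite eq_sym.
have Nq : nbr H q = nbr G q :\ v.
  rewrite nbr_step_wq //; apply/setUidPr; rewrite sub1set in_setD1 nbrE (adjC G q p) apq.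
  by rewrite eq_sym vp'.
apply/hubsP; split.
- by have := deg_step_wq qp vq; rewrite (adjC G q p) apq dq; clear; lia.
- rewrite Nq; apply/subsetP => y yN; have [->|yp] := eqVneq y p; first exact: pF'.
  have : y \in A by rewrite AE in_setD1 yp.
  rewrite inE => /and3P[yF qy _]; apply: step_high => //.
  by rewrite eq_sym (adj_neq qy).
have /card_gt0P[y yA] : 0 < #|A| by rewrite cA.
have := yA; rewrite inE => /and3P[yF qy /sepableP[X [S sp]]].
have vy : v != y by apply: contraTneq yF => <-.
have big x : x \in F -> 3 < deg G x by rewrite inE.
have X2 := sep_large sp (big q qF); have Y2 := sep_large (sepC sp) (big y yF).
have [X' [S' [sp' X2']]] := persist c3G dv vp nc vq' vy sp X2 Y2.
exists y, X', S'; split => //.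
  by rewrite -nbrE Nq in_setD1 eq_sym vy nbrE.
apply: X2' => // vX; rewrite ltnNge; apply/negP => X2''.
have qX : q \in X by case/and5P: sp.
have qv : q != v by rewrite eq_sym.
(* If the side were [q] and [v], then [S] would be [w] and [p], and [q] would have no neighbours
   besides [v], [y] and [p]. *)
have XE := set2_eq X2'' qX vX qv.
have NS z : adj G v z -> z != q -> z \in S.
  move=> vz zq; apply/negPn/negP => zS.
  have zX : z \notin X by rewrite XE !inE negb_or zq eq_sym (adj_neq vz).
  by have [ve _] := sep_adj sp vz vX zX zS; rewrite ve eqxx in qv.
have S2 : #|S| <= 2 by case/and5P: sp => _ _ _ _ /andP[].
have SE := set2_eq S2 (NS w vw wq) (NS p vp pq) wp.
have wNq : adj G q w = false.
  apply/negP => qw; have : w \in A by rewrite AE !inE wp eq_sym vw' qw.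
  by rewrite inE => /and3P[_ _ s]; apply: triangle_wq; [rewrite sepableC | rewrite adjC].
have : nbr G q \subset [set v; y; p].
  apply/subsetP => z; rewrite nbrE => qz; rewrite !inE.
  have [zX|zX] := boolP (z \in X).
    move: zX; rewrite XE !inE => /orP[/eqP zq|->//].
    by rewrite zq adj_irr in qz.
  have [zS|zS] := boolP (z \in S).
    move: zS; rewrite SE !inE => /orP[/eqP zw|->]; last by rewrite orbT.
    by rewrite zw wNq in qz.
  by have [_ ->] := sep_adj sp qz qX zX zS; rewrite eqxx orbT.
by move/deg_le; rewrite dq -setUA !cardsU1 cards1; clear; lia.
Qed.

Lemma excess_step : q \notin F' -> excess G -> excess H.
Proof.
move=> qF' /exists_inP[x xF dx].
have xq : x != q by apply: contraTneq dx => ->; rewrite -leqNgt (q_drops qF').2.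
have xv : x != v by apply: contraNneq vF => <-.
apply/exists_inP; exists x; first exact: step_high.
exact: leq_trans dx (deg_step_ge xv xq).
Qed.

Lemma excess_new : ~~ adj G p q -> excess H.
Proof.
move=> npq; apply/exists_inP; exists p; first exact: pF'.
by rewrite deg_step_p npq addn1 ltnS; have := bigN vp; rewrite inE.
Qed.

Lemma q_stays : ~~ adj G p q -> q \in F'.
Proof.
move=> npq; have qF := bigN vq; have := deg_step_wq _ vq; rewrite eq_sym pq => /(_ isT).
by rewrite (adjC G q p) (negbTE npq) addn0 inE => ->; move: qF; rewrite inE.
Qed.

Definition hub_bounded (K : sgraph T) :=
  2 * #|high K| + #|hubs K| + 4 + excess K <= \sum_(x in high K) wdeg K x.

Lemma hubs_stay : q \in F' -> #|hubs G| <= #|hubs H|.+1.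
Proof.
move=> qF'; apply: leq_trans (_ : #|v |: hubs H| <= _); last first.
  by rewrite cardsU1; case: (_ \notin _).
apply: subset_leq_card; apply/subsetP => u uG; rewrite in_setU1.
by have [//|uv] := eqVneq u v; apply: (hub_step uG uv); rewrite qF'.
Qed.

Lemma hubs_nF u : u \in hubs G -> u \notin F.
Proof. by case/hubsP => du _ _; rewrite inE du. Qed.

Lemma step_bounded : 2 < #|hubs G| -> conn3 H ->
  (hubs H != set0 -> hub_bounded H) -> hub_bounded G.
Proof.
move=> hubs3 c3H IH; rewrite /hub_bounded -/F; rewrite /hub_bounded -/F' in IH.
have [qF'|qF'] := boolP (q \in F').
  have := weight_step qF'; have := hubs_stay qF'.
  have : hubs H != set0.
    by rewrite -card_gt0; move: (hubs_stay qF') hubs3; clear; lia.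
  move/IH; rewrite -/F' (step_eq qF').
  (* If [p] and [q] are adjacent, the two extra units of [weight_step] cover [excess G]; if not,
     [excess] holds after the contraction. *)
  have [apq|napq] := boolP (adj G p q).
    by case: (excess G); clear; lia.
  by rewrite (excess_new napq); case: (excess G); clear; lia.
have wD := weight_stepD qF'; have [apq dq] := q_drops qF'.
have qF := bigN vq.
have cF : #|F| = #|F'|.+1 by rewrite (step_eqD qF') (cardsD1 q F) qF.
have exH : excess G <= excess H.
  by case exG: (excess G) => //; rewrite excess_step.
pose M := (hubs G :&: nbr G q) :\ v.
pose A := [set y in F | adj G q y && sepable G q y].
have inA y : (y \in A) = [&& y \in F, adj G q y & sepable G q y] by rewrite in_set.
(* Two of the four neighbours of [q] are [v] and [p], and these are in neither set. *)
have cMA : #|M| + #|A| <= 2.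
  have : [set v; p] :|: (M :|: A) \subset nbr G q.
    rewrite !subUset !sub1set !nbrE (adjC G q p) apq adjC vq /=.
    by apply/andP; split; apply/subsetP => y; rewrite !inE => /and3P[].
  move/subset_leq_card; rewrite -/(deg G q) dq cardsU cards2 vp' (cardsU M).
  have -> : M :&: A = set0.
    apply/setP => y; rewrite in_setI in_set0 in_setD1 in_setI; apply/negP.
    case/andP => /and3P[_ /hubs_nF yF _]; by rewrite inA (negbTE yF).
  have -> : [set v; p] :&: (M :|: A) = set0.
    apply/setP => y; rewrite in_setI in_set0 in_set2 [_ \in M :|: _]in_setU; apply/negP.
    case/andP => /orP[]/eqP->; rewrite in_setD1 in_setI inA.
      by rewrite eqxx (negbTE vF).
    case/orP=> [/and3P[_ /hubs_nF]|/and3P[_ _]]; first by rewrite bigN.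
    by rewrite sepableC => /triangle_pq.
  by rewrite cards0; clear; lia.
have hM : #|hubs G| <= 1 + #|M| + #|hubs H|.
  apply: leq_trans (_ : #|v |: (M :|: hubs H)| <= _); last first.
    by rewrite cardsU1 cardsU; case: (_ \notin _); clear; lia.
  apply: subset_leq_card; apply/subsetP => u uG; rewrite in_setU1.
  have [//|uv] := eqVneq u v; rewrite in_setU in_setD1 in_setI uv uG nbrE !andTb adjC.
  have [//|uq] := boolP (adj G u q).
  by apply: (hub_step uG uv); rewrite uq orbT.
have sA : sdeg G q = #|A| by [].
(* With two separable edges at [q] no hub next to it is lost and [q] is a new one. With at most one,
   the gain [6 - 2 * #|A|] pays for the loss of [v], of [M] and of the high vertex [q]. *)
have [j2|j2] := eqVneq #|A| 2.
  have qH := hub_q qF' j2.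
  have qG : q \notin hubs G by apply/negP => /hubs_nF; rewrite qF.
  have hH : #|hubs G| <= #|hubs H|.
    have := cardsD1 q (hubs H); rewrite qH => ->.
    apply: leq_trans (_ : #|v |: (hubs H :\ q)| <= _); last first.
      by rewrite cardsU1; case: (_ \notin _); clear; lia.
    have M0 : M = set0 by apply/eqP; rewrite -cards_eq0; move: cMA j2; clear; lia.
    apply: subset_leq_card; apply/subsetP => u uG; rewrite in_setU1.
    have [//|uv] := eqVneq u v; rewrite in_setD1; apply/andP; split.
      by apply: contraNneq qG => <-.
    apply: (hub_step uG uv); apply/orP; right; apply/negP => uq.
    by have := in_set0 u; rewrite -M0 in_setD1 in_setI uv uG nbrE adjC uq.
  have /IH : hubs H != set0 by apply/set0Pn; exists q.
  by move: wD hH cF exH; rewrite sA j2; clear; lia.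
have [H0|H0] := eqVneq (hubs H) set0; last first.
  move: (IH H0) wD hM cMA j2 cF exH; rewrite sA -/F'; clear; lia.
move: hM; rewrite H0 cards0 => hM.
have [u uM] : exists u, u \in M.
  by apply/set0Pn; rewrite -card_gt0; move: hM hubs3; clear; lia.
have := uM; rewrite in_setD1 in_setI nbrE => /and3P[uv uG qu].
have [du Nu _] := hubsP G u uG.
have vu : ~~ adj G v u by apply: contraNN (hubs_nF uG) => /bigN.
have up : u != p by apply: contraNneq (hubs_nF uG) => ->; apply: bigN.
have duH : deg H u = 3 by rewrite deg_step.
have := low_bound c3H duH.
have : 2 <= #|nbr H u :&: F'|.
  have := cardsD1 q (nbr G u); rewrite nbrE adjC qu -/(deg G u) du.
  suff /subset_leq_card : nbr G u :\ q \subset nbr H u :&: F' by clear; lia.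
  apply/subsetP => y; rewrite in_setD1 => /andP[yq yN].
  by rewrite inE nbr_step // yN step_high // (subsetP Nu).
by move: wD hM cMA j2 cF exH hubs3; rewrite sA -/F'; clear; lia.
Qed.

End Step.

(** * Induction on the number of vertices *)

Section HubBound.
Context {T : finType}.
Implicit Types (G : sgraph T).

Lemma vset_high G x : x \in high G -> 4 < #|vset G|.
Proof.
rewrite inE => dx; have : x |: nbr G x \subset vset G.
  rewrite subUset sub1set deg_vset; last by move: dx; clear; lia.
  by apply/subsetP => y; rewrite nbrE; apply: adj_vsetr.
move/subset_leq_card; rewrite cardsU1 nbrE adj_irr /=.
by move: dx; rewrite /deg; clear; lia.
Qed.

Lemma hub_bound G : conn3 G -> hubs G != set0 -> hub_bounded G.
Proof.
have [n] := ubnP #|vset G|; elim: n G => // n IH G Gn c3G hG.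
have /set0Pn[v vG] := hG; have [dv NF _] := hubsP G v vG.
have [h2|h3] := leqP #|hubs G| 2.
  (* The three high neighbours of a hub contribute 6, which is enough for two hubs. *)
  have := low_bound c3G dv; rewrite (setIidPl NF) -/(deg G v) dv /hub_bounded.
  by move: h2; clear; lia.
have [w [p [q [[vw vp vq Nv] [[wp wq pq wNp] [nc swp]]]]]] := hub_contract c3G vG.
have pF : p \in high G by apply: (subsetP NF); rewrite nbrE.
have c3H := contract_conn3 c3G vp (vset_high pF) nc.
apply: (step_bounded c3G dv NF vw vp vq Nv wp wq pq wNp nc swp h3 c3H) => hH.
apply: IH => //; have := card_contract p (adj_vset vp).
by move: Gn; clear; lia.
Qed.

End HubBound.

(** * The bound *)

Section Final.
Context {T : finType}.
Implicit Types (G : sgraph T) (X Y Z K S P Q R D : {set T}).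

Definition cubic G := [set x | deg G x == 3].

(** Only the first contraction uses minimality: by [triangle_low] the vertices [p] and [q] are not
    adjacent, so the contraction has [excess], whose unit raises the constant from 4 to 5. *)
Lemma hub_bound_minimal G : conn3 G ->
  (forall x y, x \in high G -> y \in high G -> adj G x y -> sepable G x y) ->
  hubs G != set0 ->
  2 * #|high G| + #|hubs G| + 5 <= \sum_(x in high G) wdeg G x.
Proof.
move=> c3G minG hG; have /set0Pn[v vG] := hG; have [dv NF _] := hubsP G v vG.
have [h1|h2] := leqP #|hubs G| 1.
  have := low_bound c3G dv; rewrite (setIidPl NF) -/(deg G v) dv.
  by move: h1; clear; lia.
have [w [p [q [[vw vp vq Nv] [[wp wq pq wNp] [nc swp]]]]]] := hub_contract c3G vG.
have big y : adj G v y -> y \in high G by move=> vy; apply: (subsetP NF); rewrite nbrE.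
have npq : ~~ adj G p q.
  apply/negP => apq; have := triangle_low c3G dv (big p vp) (big q vq) vp vq apq.
  by rewrite minG // big.
have qH := q_stays NF vp vq pq npq.
have c3H := contract_conn3 c3G vp (vset_high (big p vp)) nc.
have hle := hubs_stay c3G dv NF vw vp vq Nv wp wq pq wNp nc qH.
have := weight_step c3G dv NF vw vp vq Nv wp wq pq wNp nc swp qH.
have : hub_bounded (contract G v p).
  by apply: (hub_bound c3H); rewrite -card_gt0; move: hle h2; clear; lia.
rewrite /hub_bounded (excess_new dv NF vw vp vq Nv wp wq pq wNp npq).
rewrite (step_eq dv NF vw vp vq Nv wp wq pq wNp qH).
by move: hle; clear; lia.
Qed.

Lemma weight_cubic G : conn3 G ->
  (forall x y, x \in high G -> y \in high G -> adj G x y -> sepable G x y) ->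
  \sum_(x in high G) wdeg G x = \sum_(y in cubic G) #|nbr G y :&: high G|.
Proof.
move=> c3G minG.
have E (x : T) (A B : {set T}) : #|A :&: B| = \sum_(y in B) (y \in A : nat).
  rewrite -sum1_card big_mkcond [RHS]big_mkcond; apply: eq_bigr => y _.
  by rewrite inE; case: (y \in A); case: (y \in B).
transitivity (\sum_(x in high G) #|nbr G x :&: cubic G|).
  apply: eq_bigr => x xF; apply: eq_card => y; rewrite [in LHS]in_set in_setI nbrE !in_set.
  case xy: (adj G x y) => //=; have := conn3_deg c3G (adj_vsetr xy).
  case yF: (3 < deg G y) => /=; last by move: yF; case: (deg G y) => [|[|[|[|]]]].
  by rewrite (minG x y xF _ xy) ?inE // => _; move: yF; case: (deg G y) => [|[|[|[|]]]].
rewrite (eq_bigr (fun x => \sum_(y in cubic G) (y \in nbr G x : nat))); last by move=> x _; exact: E.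
rewrite exchange_big /=; apply: eq_bigr => y _; rewrite (E y).
by apply: eq_bigr => x _; rewrite !inE adjC.
Qed.

(* After contraction of [x] into [t1], [y] has three high neighbours. *)
Lemma cubic_edge_contradiction G x t1 t2 y : conn3 G ->
  (forall x y, x \in high G -> y \in high G -> adj G x y -> sepable G x y) ->
  deg G x = 3 -> deg G y = 3 -> t1 \in high G -> t2 \in high G ->
  adj G x t1 -> adj G x t2 -> adj G x y -> nbr G x = [set y; t1; t2] ->
  #|nbr G y :&: high G| = 2 -> ~~ cut_through G x t1 ->
  \sum_(z in high G) sdeg G z + 6 <= 2 * #|high G|.
Proof.
move=> c3G minG dx dy t1F t2F xt1 xt2 xy Nx cy nc.
have xF : x \notin high G by rewrite inE dx.
have yF : y \notin high G by rewrite inE dy.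
have c3H := contract_conn3 c3G xt1 (vset_high t1F) nc; set H := contract G x t1 in c3H *.
have Nxz z : adj G x z -> [|| z == y, z == t1 | z == t2] by rewrite -nbrE Nx !inE orbA.
have yt1 : y != t1 by apply: contraNneq yF => ->.
have yx : y != x by rewrite eq_sym (adj_neq xy).
have t1x : t1 != x by rewrite eq_sym (adj_neq xt1).
have NyH : nbr H y = t1 |: (nbr G y :\ x) by rewrite nbr_contract // xy.
have dyH : deg H y <= 3.
  rewrite /deg NyH cardsU1; have := cardsD1 x (nbr G y); rewrite nbrE adjC xy -/(deg G y) dy.
  by clear; lia.
have dyH3 : deg H y = 3.
  have /(conn3_deg c3H) : y \in vset H by rewrite !inE yx (adj_vsetr xy).
  by move: dyH; clear; lia.
have t1y : ~~ adj G y t1.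
  apply/negP => yt; have : nbr H y = nbr G y :\ x.
    by rewrite NyH; apply/setUidPr; rewrite sub1set !inE t1x yt.
  move=> NE; move: dyH3; rewrite /deg NE; have := cardsD1 x (nbr G y).
  by rewrite nbrE adjC xy -/(deg G y) dy; clear; lia.
have t12 : ~~ adj G t1 t2.
  by apply/negP => a12; have := triangle_low c3G dx t1F t2F xt1 xt2 a12; rewrite minG.
have degH z : z != x -> z != t1 -> z != y -> deg H z = deg G z.
  move=> zx zt1 zy; rewrite /deg nbr_contract //; case: ifP => // /Nxz.
  rewrite (negbTE zt1) (negbTE zy) /= => /eqP zt2; subst z.
  rewrite cardsU1 !inE t1x adjC (negbTE t12) andbF /=.
  by have := cardsD1 x (nbr G t2); rewrite nbrE adjC xt2; clear; lia.
have degHt1 : deg G t1 <= deg H t1.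
  rewrite /deg nbr_contract_p // Nx.
  have := cardsD1 x (nbr G t1); rewrite nbrE adjC xt1 => ->.
  apply: leq_trans (_ : #|y |: (nbr G t1 :\ x)| <= _).
    by rewrite cardsU1 !inE yx adjC (negbTE t1y).
  apply: subset_leq_card; apply/subsetP => z; rewrite !inE => /orP[/eqP->|->//].
  by rewrite yt1 eqxx orbT.
have FE : high H = high G.
  apply/setP => z; have [->|zx] := eqVneq z x.
    rewrite !inE dx; apply/negbTE; rewrite -leqNgt.
    suff -> : deg H x = 0 by [].
    by apply/eqP; rewrite cards_eq0; apply/eqP/setP => u; rewrite nbrE inE;
      apply/negP => /adj_contract[]; rewrite eqxx.
  have [->|zy] := eqVneq z y; first by rewrite !inE dy dyH3.
  have [->|zt1] := eqVneq z t1; last by rewrite !inE degH.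
  by rewrite t1F inE; move: t1F; rewrite inE => dt; apply: leq_trans dt degHt1.
have := count_low c3H dyH3; rewrite FE.
have c3 : 3 <= #|nbr H y :&: high G|.
  apply: leq_trans (_ : #|t1 |: (nbr G y :&: high G)| <= _).
    by rewrite cardsU1 cy in_setI nbrE (negbTE t1y).
  apply: subset_leq_card; apply/subsetP => z; rewrite in_setU1 !in_setI NyH in_setU1 in_setD1.
  case/orP=> [/eqP->|/andP[-> zF]]; first by rewrite eqxx t1F.
  have zx : z != x by apply: contraTneq zF => ->.
  by rewrite zF zx orbT.
have : \sum_(z in high G) sdeg G z <= \sum_(z in high G) sdeg H z.
  apply: leq_sum => z zF; apply: subset_leq_card; apply/subsetP => u.
  rewrite !in_set => /and3P[uF zu s].
  have uF' : u \in high G by rewrite inE.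
  have uH : u \in high H by rewrite FE.
  move: uH; rewrite inE => -> /=.
  rewrite (persist_high c3G dx xt1 nc zF uF' s) andbT.
  apply: adj_contract_old => //; first by apply: contraTneq zF => ->.
  by apply: contraTneq uF' => ->.
by move: c3; clear; lia.
Qed.

Lemma cubic_bound G : conn3 G ->
  (forall x y, x \in high G -> y \in high G -> adj G x y -> sepable G x y) ->
  (forall v, deg G v = 3 -> nbr G v \subset high G -> v \in hubs G) ->
  #|high G| + 3 <= #|cubic G|.
Proof.
move=> c3G minG critG; have WE := weight_cubic c3G minG.
have VE : #|vset G| <= #|high G| + #|cubic G|.
  apply: leq_trans (_ : #|high G :|: cubic G| <= _); last by rewrite cardsU; clear; lia.
  apply: subset_leq_card; apply/subsetP => x /(conn3_deg c3G).
  by rewrite !inE leq_eqVlt eq_sym orbC.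
have V4 : 3 < #|vset G| by case: c3G.
have [F0|F0] := eqVneq (high G) set0.
  by move: VE V4; rewrite F0 cards0; clear; lia.
have c3 y : y \in cubic G -> #|nbr G y :&: high G| <= 3.
  by rewrite inE => /eqP <-; apply: subset_leq_card; apply: subsetIl.
have [h0|h0] := eqVneq (hubs G) set0; last first.
  (* The count gives [2 * #|high G| + 5 <= 2 * #|cubic G|], and parity yields the last unit. *)
  have := hub_bound_minimal c3G minG h0; rewrite WE.
  have hsub : hubs G \subset cubic G.
    by apply/subsetP => v /hubsP[dv _ _]; rewrite inE dv.
  have : \sum_(y in cubic G) #|nbr G y :&: high G| <= \sum_(y in cubic G) (2 + (y \in hubs G)).
    apply: leq_sum => y yC; have := c3 y yC; rewrite leq_eqVlt => /orP[/eqP e3|]; last first.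
      by move=> h; apply: leq_trans h (leq_addr _ _).
    suff -> : y \in hubs G by rewrite e3.
    move: yC; rewrite inE => /eqP dy; apply: critG => //.
    by apply/setIidPl/eqP; rewrite eqEcard subsetIl e3 -/(deg G y) dy.
  rewrite big_split /= sum_nat_const.
  have -> : \sum_(y in cubic G) (y \in hubs G : nat) = #|hubs G|.
    rewrite -sum1_card big_mkcond [RHS]big_mkcond; apply: eq_bigr => y _.
    by have := subsetP hsub y; case: (y \in hubs G) => [->|_] //; case: ifP.
  by clear; lia.
have c2 y : y \in cubic G -> #|nbr G y :&: high G| <= 2.
  move=> yC; have := c3 y yC; rewrite leq_eqVlt => /orP[/eqP e3|//].
  have : y \in hubs G; last by rewrite h0 inE.
  move: yC; rewrite inE => /eqP dy; apply: critG => //.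
  by apply/setIidPl/eqP; rewrite eqEcard subsetIl e3 -/(deg G y) dy.
have B2 : \sum_(y in cubic G) #|nbr G y :&: high G| <= 2 * #|cubic G|.
  by rewrite mulnC -sum_nat_const; apply: leq_sum.
have := sum_deg G; rewrite wdeg_sum WE => sD.
have [/exists_inP[x xC /eqP cx]|none] := boolP [exists x in cubic G, #|nbr G x :&: high G| == 2]; last first.
  have : \sum_(y in cubic G) #|nbr G y :&: high G| <= \sum_(y in cubic G) 1.
    apply: leq_sum => y yC; have := c2 y yC; rewrite leq_eqVlt => /orP[e2|//].
    by case: (negP none); apply/exists_inP; exists y.
  have F1 : 0 < #|high G| by rewrite card_gt0.
  by rewrite sum1_card; have := count_high c3G F0; move: sD F1; clear; lia.
have dx : deg G x = 3 by move: xC; rewrite inE => /eqP.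
have := low_bound c3G dx; rewrite cx WE => lb.
rewrite leqNgt; apply/negP => small.
(* A counterexample attains equality: [#|cubic G|] is [#|high G| + 2], every cubic vertex has
   exactly two high neighbours, and the sum of [sdeg] is at least [2 * #|high G| - 4]. The bound of
   [cubic_edge_contradiction] is smaller by two. *)
have all2 y : y \in cubic G -> #|nbr G y :&: high G| = 2.
  move=> yC; apply/eqP; rewrite eqn_leq c2 //= leqNgt; apply/negP => y1.
  move: lb; rewrite (big_setD1 y yC) /=.
  have : \sum_(i in cubic G :\ y) #|nbr G i :&: high G| <= #|cubic G :\ y| * 2.
    by rewrite -sum_nat_const; apply: leq_sum => i; rewrite in_setD1 => /andP[_ /c2].
  by move: small y1; rewrite (cardsD1 y (cubic G)) yC; clear; lia.
have /cards2P[t1 [t2 [t12 tE]]] : #|nbr G x :&: high G| == 2 by rewrite cx.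
have [xt1 t1F] : adj G x t1 /\ t1 \in high G.
  by have := set21 t1 t2; rewrite -tE in_setI nbrE => /andP.
have [xt2 t2F] : adj G x t2 /\ t2 \in high G.
  by have := set22 t1 t2; rewrite -tE in_setI nbrE => /andP.
have [y xy yF] : exists2 y, adj G x y & y \notin high G.
  have [y yN yF] : exists2 y, y \in nbr G x & y \notin high G.
    apply/subsetPn/negP => /setIidPl NE; move: cx; rewrite NE -/(deg G x) dx //.
  by exists y; rewrite -?nbrE.
have yC : y \in cubic G.
  have := conn3_deg c3G (adj_vsetr xy); move: yF; rewrite !inE.
  by case: (deg G y) => [|[|[|[|]]]].
have dy : deg G y = 3 by move: yC; rewrite inE => /eqP.
have yt1 : y != t1 by apply: contraNneq yF => ->.
have yt2 : y != t2 by apply: contraNneq yF => ->.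
have Nx : nbr G x = [set y; t1; t2].
  apply/esym/eqP; rewrite eqEcard !subUset !sub1set !nbrE xy xt1 xt2 /=.
  by rewrite -/(deg G x) dx -setUA cardsU1 cards2 !inE negb_or yt1 yt2 t12.
have dt2 : 3 < deg G t2 by move: t2F; rewrite inE.
have fin t t' : t \in high G -> t' \in high G -> adj G x t -> adj G x t' ->
    nbr G x = [set y; t; t'] -> ~~ cut_through G x t -> False.
  move=> tF t'F xt xt' NE nc.
  have := cubic_edge_contradiction c3G minG dx dy tF t'F xt xt' xy NE (all2 y yC) nc.
  by move: sD lb small B2; clear; lia.
have [ct1|ct1] := boolP (cut_through G x t1); last by apply: (fin t1 t2).
apply: (fin t2 t1) => //; first by rewrite Nx setUAC.
apply/negP => ct2; apply: (one_cut_through c3G xy xt1 xt2 _ yt1 yt2 t12 dt2 ct1 ct2).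
by rewrite Nx.
Qed.

(** Both sides of the 3-cut contain a neighbour of [v]. As there are only three, one side contains
    exactly one, and the edge to it is the single edge required by [hubs]. *)
Lemma hub_of_cut G v (A K : {set T}) : conn3 G -> deg G v = 3 -> nbr G v \subset high G ->
  A \subset vset G -> closed_off G A (v |: K) -> [disjoint A & v |: K] ->
  v \notin K -> #|K| <= 2 -> A != set0 -> far G A (v |: K) != set0 -> v \in hubs G.
Proof.
move=> c3G dv NF AV clA dA vK K2 A0 B0.
set B := far G A (v |: K) in B0 *.
have clB : closed_off G B (v |: K).
  move=> x y xB xy yB; have yV := adj_vsetr xy.
  have [xA xK] : x \notin A /\ x \notin v |: K.
    by move: xB; rewrite inE in_setU negb_or => /andP[/andP[]].
  apply: contraNT yB => yK; rewrite inE in_setU negb_or yK yV !andbT.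
  by apply/negP => yA; rewrite adjC in xy; have := clA y x yA xy xA; rewrite (negbTE xK).
have BV : B \subset vset G by apply: subsetDl.
have dB : [disjoint B & v |: K].
  by rewrite disjoints_subset; apply/subsetP => x; rewrite inE in_setU in_setC;
    case: (x \in v |: K); rewrite ?orbT.
have vV : v \in vset G by apply: deg_vset; rewrite dv.
have notin Z x : [disjoint Z & v |: K] -> x \in Z -> x \notin v |: K.
  by move=> dZ xZ; rewrite (disjointFr dZ).
have nbrIn Z o : Z \subset vset G -> closed_off G Z (v |: K) -> Z != set0 ->
    o \in vset G -> o \notin Z -> o \notin v |: K -> 0 < #|nbr G v :&: Z|.
  move=> ZV clZ /set0Pn[z zZ] oV oZ oK; rewrite card_gt0; apply/negP => /eqP none.
  have oK' : o \notin K by apply: contraNN oK => oK'; rewrite in_setU1 oK' orbT.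
  apply: (conn3_use c3G ZV _ zZ oV oZ oK' K2) => x y xZ xy yZ.
  have := clZ x y xZ xy yZ; rewrite in_setU1 => /orP[/eqP yv|//].
  by have := in_set0 x; rewrite -none in_setI nbrE xZ adjC -yv xy.
have [a aA] := set0Pn _ A0; have [b bB] := set0Pn _ B0.
have bA : b \notin A by move: bB; rewrite !inE; case: (b \in A).
have aB : a \notin B by rewrite !inE aA.
have nA := nbrIn A b AV clA A0 (subsetP BV _ bB) bA (notin _ _ dB bB).
have nB := nbrIn B a BV clB B0 (subsetP AV _ aA) aB (notin _ _ dA aA).
have main Z b0 : Z \subset vset G -> closed_off G Z (v |: K) -> [disjoint Z & v |: K] ->
   #|nbr G v :&: Z| = 1 -> b0 \in vset G -> b0 \notin Z -> b0 \notin v |: K -> v \in hubs G.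
  move=> ZV clZ dZ /eqP/cards1P[w wE] bV bZ bK.
  have [vw wZ] : adj G v w /\ w \in Z.
    by have := set11 w; rewrite -wE in_setI nbrE => /andP.
  have vZ : v \notin Z by apply/negP => /(notin _ _ dZ); rewrite in_setU1 eqxx.
  have sp : sep G w v Z K.
    apply: sep_intro => //.
      by apply: disjointWr dZ; apply: subsetUr.
    move=> x y xZ yZ yK xy; have := clZ x y xZ xy yZ.
    rewrite in_setU1 (negbTE yK) orbF => /eqP yv; split => //.
    have : x \in nbr G v :&: Z by rewrite in_setI nbrE xZ adjC -yv xy.
    by rewrite wE inE => /eqP.
  apply/hubsP; split => //; exists w, (far G Z K), K; split => //; first exact: sepC.
  move: bK; rewrite in_setU1 negb_or => /andP[bv bK].
  apply: leq_trans (_ : #|[set v; b0]| <= _); first by rewrite cards2 eq_sym bv.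
  apply: subset_leq_card; apply/subsetP => x; rewrite !inE negb_or.
  by case/orP => /eqP->; rewrite ?vZ ?vK ?vV ?bZ ?bK ?bV.
have nAB : #|nbr G v :&: A| + #|nbr G v :&: B| <= 3.
  rewrite -dv -cardsUI.
  have -> : nbr G v :&: A :&: (nbr G v :&: B) = set0.
    by apply/setP => x; rewrite !inE; case: (x \in A); rewrite ?andbF.
  by rewrite cards0 addn0 -setIUr; apply: subset_leq_card; apply: subsetIl.
have [n1|n2] := leqP #|nbr G v :&: A| 1.
  apply: (main A b) => //; [by move: n1 nA; clear; lia | exact: subsetP BV _ bB | exact: notin bB].
apply: (main B a) => //; [by move: n2 nB nAB; clear; lia | exact: subsetP AV _ aA | exact: notin aA].
Qed.

End Final.

(** * From the boolean definitions to separations *)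

Lemma three_connected_cut (T : finType) (e : rel T) (X K : {set T}) x y :
  symmetric e -> three_connected e ->
  (forall u w, u \in X -> e u w -> w \notin X -> w \in K) ->
  x \in X -> x \notin K -> y \notin X -> y \notin K -> 2 < #|K|.
Proof.
move=> e_sym /andP[_ /forallP/(_ K) H] clX xX xK yX yK; rewrite ltnNge.
apply/negP => K2; move: H; rewrite ltnS K2 /= /vertex_cut negbK.
move/forallP/(_ (Sub x xK))/forallP/(_ (Sub y yK)) => conn.
pose a := [pred u : {x : T | x \notin K} | val u \in X].
have cl : fingraph.closed (del_vertices e K) a.
  move=> u w /= uw; apply/idP/idP => h.
    by apply: contraT => wX; have := clX _ _ h uw wX; rewrite (negbTE (valP w)).
  have wu : e (val w) (val u) by rewrite e_sym.
  by apply: contraT => uX; have := clX _ _ h wu uX; rewrite (negbTE (valP u)).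
by have := closed_connect cl conn; rewrite !inE /= xX (negbTE yX).
Qed.

Lemma not_three_connected_cut (T : finType) (e : rel T) :
  3 < #|T| -> ~~ three_connected e -> exists X K : {set T},
  [/\ [disjoint X & K], #|K| <= 2, X != set0, ~: (X :|: K) != set0 &
   forall u w, u \in X -> e u w -> w \notin X -> w \in K].
Proof.
move=> T3; rewrite /three_connected T3 /= => /forallPn[K].
rewrite negb_imply negbK ltnS => /andP[K2] /forallPn[x] /forallPn[y nxy].
exists [set val u | u in connect (del_vertices e K) x], K; split => //.
- rewrite disjoints_subset; apply/subsetP => _ /imsetP[u _ ->].
  by rewrite inE (valP u).
- by apply/set0Pn; exists (val x); apply/imsetP; exists x => //; rewrite inE connect0.
- apply/set0Pn; exists (val y); rewrite inE in_setU negb_or (valP y) andbT.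
  by apply: contraNN nxy => /imsetP[u + /val_inj->].
move=> _ w /imsetP[u xu ->] uw; apply: contraNT => wK.
apply/imsetP; exists (Sub w wK); rewrite ?SubK //.
by rewrite inE; apply: connect_trans xu _; apply: connect1.
Qed.

Definition graph_of (T : finType) (e : rel T) (e_sym : symmetric e)
    (e_irr : irreflexive e) : sgraph T :=
  @SGraph T setT e e_sym e_irr (fun x y _ => in_setT x).

Section Translation.
Variables (T : finType) (e : rel T).
Hypotheses (e_sym : symmetric e) (e_irr : irreflexive e).
Let G := graph_of e_sym e_irr.

Lemma graph_of_conn3 : three_connected e -> conn3 G.
Proof.
move=> e3; split; first by rewrite cardsT; case/andP: e3.
move=> X K x y _ clX xX xK _ yX yK; exact: (three_connected_cut e_sym e3 clX xX xK yX yK).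
Qed.

(** A small cut of the graph without [xy] is no cut of [G], so some edge of [G] joins its sides, and
    only [xy] can. *)
Lemma graph_of_sepable x y : minimally_three_connected e -> e x y -> sepable G x y.
Proof.
case/andP=> e3 /forallP/(_ x)/forallP/(_ y)/implyP min xy; have c3G := graph_of_conn3 e3.
have T3 : 3 < #|T| by case/andP: e3.
have [X [K [dXK K2 /set0Pn[x0 x0X] /set0Pn[y0]]]] := not_three_connected_cut T3 (min xy).
rewrite !inE negb_or => /andP[y0X y0K] clX.
have step u w : u \in X -> e u w -> w \notin X -> w \notin K -> [set u; w] = [set x; y].
  move=> uX uw wX; apply: contraNeq => uwxy; apply: (clX u) => //=.
  by rewrite /del_edge /= uw.
have [u [w [uX wX wK uw]]] : exists u w, [/\ u \in X, w \notin X, w \notin K & e u w].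
  have [/existsP[u /existsP[w /and4P[? ? ? ?]]]|none] :=
    boolP [exists u, exists w, [&& u \in X, w \notin X, w \notin K & e u w]].
    by exists u, w.
  exfalso; apply: (conn3_use c3G (subsetT X) _ x0X (in_setT y0) y0X y0K K2) => u w uX uw wX.
  apply: contraNT none => wK; apply/existsP; exists u; apply/existsP; exists w.
  by apply/and4P.
have suw : sep G u w X K.
  apply: sep_intro => //; try exact: in_setT; first exact: subsetT.
  move=> u' w' u'X w'X w'K uw'.
  have E : [set u'; w'] = [set u; w] by rewrite (step u w) // (step u' w').
  have : u' \in [set u; w] by rewrite -E !inE eqxx.
  rewrite !inE => /orP[/eqP->|/eqP uw2]; last by rewrite -uw2 u'X in wX.
  have : w' \in [set u; w] by rewrite -E !inE eqxx orbT.
  rewrite !inE => /orP[/eqP wu|/eqP->//].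
  by rewrite wu uX in w'X.
have suw' : sepable G u w by apply/sepableP; exists X, K.
have E := step u w uX uw wX wK.
have xE : x \in [set u; w] by rewrite E !inE eqxx.
have yE : y \in [set u; w] by rewrite E !inE eqxx orbT.
move: xE yE xy; rewrite !inE => /orP[]/eqP-> /orP[]/eqP->; rewrite ?e_irr // => _.
by rewrite sepableC.
Qed.

Lemma graph_of_hub v : critically_three_connected e -> deg G v = 3 ->
  nbr G v \subset high G -> v \in hubs G.
Proof.
case/andP=> e3 /forallP/(_ v) nc dv NF; have c3G := graph_of_conn3 e3.
(* The graph without [v] must still have more than three vertices, so that its failure to be
   3-connected provides a cut. *)
have T4 : 4 < #|T|.
  have [t tN] : exists t, t \in nbr G v.
    by apply/set0Pn; rewrite -card_gt0 -/(deg G v) dv.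
  by have := vset_high (subsetP NF t tN); rewrite cardsT.
have T3 : 3 < #|{: {x : T | x \notin [set v]}}|.
  rewrite card_sig; have := cardC1 v.
  rewrite -(@eq_card _ [pred x | x \notin [set v]]); last by move=> x; rewrite !inE.
  by move=> ->; move: T4; clear; lia.
have [X [K [dXK K2 /set0Pn[x0 x0X] /set0Pn[y0]]]] := not_three_connected_cut T3 nc.
rewrite in_setC in_setU negb_or => /andP[y0X y0K] clX.
have neqv (u : {x : T | x \notin [set v]}) : val u != v by have := valP u; rewrite inE.
have mem_val (Z : {set {x : T | x \notin [set v]}}) u : (val u \in val @: Z) = (u \in Z).
  by rewrite mem_imset //; apply: val_inj.
apply: (@hub_of_cut _ G v (val @: X) (val @: K) c3G dv NF).
- exact: subsetT.
- move=> _ y /imsetP[u uX ->] uy; rewrite in_setU1; case: eqVneq => //= yv.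
  have yS : y \notin [set v] by rewrite inE.
  have -> : y = val (Sub y yS : {x : T | x \notin [set v]}) by rewrite SubK.
  by rewrite !mem_val => wX; apply: (clX u) => //; rewrite /= SubK.
- rewrite disjoints_subset; apply/subsetP => _ /imsetP[u uX ->].
  by rewrite in_setC in_setU1 negb_or neqv mem_val (disjointFr dXK uX).
- by apply/imsetP => -[u _ vu]; have := neqv u; rewrite -vu eqxx.
- exact: leq_trans (leq_imset_card _ _) K2.
- by apply/set0Pn; exists (val x0); rewrite mem_val.
apply/set0Pn; exists (val y0); rewrite inE in_setT andbT in_setU in_setU1.
by rewrite !mem_val (negbTE y0X) (negbTE y0K) (negbTE (neqv y0)).
Qed.

End Translation.

Theorem theorem4p2 (T : finType) (e : rel T)
    (e_sym : symmetric e) (e_irr : irreflexive e)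
    (e_min : minimally_three_connected e)
    (e_crit : critically_three_connected e) :
  ((#|T|%:R + 3) / 2 <= (v3 e)%:R :> rat)%R.
Proof.
have c3G : conn3 (graph_of e_sym e_irr) by apply: graph_of_conn3; case/andP: e_min.
have : #|high (graph_of e_sym e_irr)| + 3 <= v3 e.
  apply: (cubic_bound c3G) => [x y _ _ xy | v]; last exact: graph_of_hub.
  exact: graph_of_sepable.
have : #|T| <= #|high (graph_of e_sym e_irr)| + v3 e.
  apply: leq_trans (leq_card_setU _ _); rewrite -cardsT.
  apply: subset_leq_card; apply/subsetP => x xT.
  by have := conn3_deg c3G xT; rewrite !inE leq_eqVlt eq_sym orbC.
move=> h1 h2; have h : #|T| + 3 <= v3 e * 2 by move: h1 h2; clear; lia.
rewrite Num.Theory.ler_pdivrMr //.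
by rewrite -(GRing.natrD _ _ 3) -(GRing.natrM _ _ 2) Num.Theory.ler_nat.
Qed.
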